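(* Let $K$ be a global function field of odd characteristic with full field of constants $\mathbb{F}_q$, and let $X$ be its set of places. Consider the following randomized procedure. 1. Pick two random places $\mathfrak{p},\mathfrak{q}\in X$ of the same degree. 2. Find $k:=\min\{j\ge1 : \dim(j\mathfrak{p}-j\mathfrak{q})\ne0\}$. 3. If $k$ is even, output a generator of the Riemann--Roch space $\mathcal{L}(k\mathfrak{p}-k\mathfrak{q})$ and terminate. 4. Otherwise, let $\zeta\in\mathbb{F}_q^\times$ be a non-square constant, and output at random (with probability $1/2$) either $\zeta$ or $1$. Then the procedure is correct: for every choice of places $\mathfrak{p},\mathfrak{q}$ of the same degree the number $k$ exists, and the output is a singular element of $K$, i.e. an element $\beta\in K^\times$ such that $\operatorname{ord}_\mathfrak{r}\beta$ is even for every $\mathfrak{r}\in X$.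
   Context: $K$ is a global function field of odd characteristic with full constant field $\mathbb{F}_q$ ($q$ a power of an odd prime). $X$ is the set of places of $K$, viewed as a smooth complete curve over $\mathbb{F}_q$; $\operatorname{ord}_\mathfrak{r}$ is the normalized valuation associated with $\mathfrak{r}\in X$. For a divisor $\mathcal{D}$ the Riemann--Roch space is $\mathcal{L}(\mathcal{D})=\{\lambda\in K^\times : \operatorname{div}_X\lambda\ge-\mathcal{D}\}\cup\{0\}$, and $\dim\mathcal{D}$ denotes its dimension over $\mathbb{F}_q$. *)

(* Defs.v *)
From HB Require Import structures.
From mathcomp Require Import all_boot all_order all_algebra all_field.
From mathcomp Require Import boolp classical_sets.
From mathcomp Require Import freeg.

Set Implicit Arguments.
Unset Strict Implicit.
Unset Printing Implicit Defensive.

Import Order.TTheory GRing.Theory Num.Theory.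

Local Open Scope ring_scope.

(* A global function field with constants F = F_q is given as a finite        *)
(* extension K of the rational function field F(t) = {fraction {poly F}}.     *)

Section FunctionField.
Variables (F : finFieldType) (K : fieldExtType {fraction {poly F}}).

Definition constf (c : F) : K := (tofrac c%:P)%:A.

Definition full_constant_field : Prop :=
  forall x : K, algebraicOver constf x -> exists c : F, x = constf c.

(* A place is a normalized discrete valuation of K. Its value at 0, which     *)
(* should be +oo, is set to 0, so that a place is determined by its values on *)
(* K^x. No triviality on F is required: F^x is finite, hence any homomorphism *)
(* F^x -> Z is trivial.                                                       *)
Record place := Place {
  ord : K -> int;
  ord0 : ord 0 = 0;
  ordM : forall x y, x != 0 -> y != 0 -> ord (x * y) = ord x + ord y;
  ordD : forall x y, x != 0 -> y != 0 -> x + y != 0 ->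
    Num.min (ord x) (ord y) <= ord (x + y);
  ord_surj : forall n : int, exists2 x, x != 0 & ord x = n
}.

HB.instance Definition _ := gen_eqMixin place.
HB.instance Definition _ := gen_choiceMixin place.

Definition valuation_ring (r : place) : set K :=
  [set x | x != 0 -> 0 <= ord r x]%classic.

Definition valuation_ideal (r : place) : set K :=
  [set x | x != 0 -> 0 < ord r x]%classic.

(* For F-subspaces W <= V of K, the classes of b_0, ..., b_(n-1) form a basis *)
(* of the F-vector space V / W.                                               *)
Definition is_basis_mod (V W : set K) n (b : n.-tuple K) : Prop :=
  (forall i, V (tnth b i)) /\
  forall x, V x -> exists! c : 'rV[F]_n,
    W (x - \sum_(i < n) constf (c 0 i) * tnth b i).

(* dim_F (V / W); the default value 0 is taken when V / W has no finite basis *)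
Definition dim_mod (V W : set K) : nat :=
  xget 0%N [set n | exists b : n.-tuple K, is_basis_mod V W b]%classic.

(* The degree of the residue field over F. *)
Definition place_deg (r : place) : nat :=
  dim_mod (valuation_ring r) (valuation_ideal r).

Definition divisor := {freeg place / int}.

Definition riemann_roch (D : divisor) : set K :=
  [set x | x != 0 -> forall r : place, - coeff r D <= ord r x]%classic.

Definition dim_div (D : divisor) : nat :=
  dim_mod (riemann_roch D) [set 0]%classic.

Definition generates (V : set K) (beta : K) : Prop :=
  forall x, V x <-> exists c : F, x = constf c * beta.

Definition singular (beta : K) : Prop :=
  beta != 0 /\ forall r : place, (2 %| ord r beta)%Z.

(* The divisor j p - j q. *)
Definition diff_div (p q : place) (j : nat) : divisor :=
  << p >> *+ j - << q >> *+ j.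

(* k = min {j >= 1 : dim (j p - j q) <> 0} *)
Definition is_first_index (p q : place) (k : nat) : Prop :=
  [/\ (1 <= k)%N, dim_div (diff_div p q k) != 0%N &
      forall j, (1 <= j)%N -> dim_div (diff_div p q j) != 0%N -> (k <= j)%N].

Definition nonsquare (zeta : F) : Prop :=
  zeta != 0 /\ forall c : F, zeta != c ^+ 2.

(* [procedure_output p q coin beta]: with the places p and q picked in the    *)
(* first step and the toss [coin] of a fair coin for the last step, the       *)
(* procedure may return beta. The choices of a generator and of a non-square  *)
(* constant are left to the procedure.                                        *)
Inductive procedure_output (p q : place) : bool -> K -> Prop :=
| Output_even k coin beta :
    is_first_index p q k -> ~~ odd k ->
    generates (riemann_roch (diff_div p q k)) beta ->
    procedure_output p q coin beta
| Output_nonsquare k zeta :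
    is_first_index p q k -> odd k -> nonsquare zeta ->
    procedure_output p q true (constf zeta)
| Output_one k :
    is_first_index p q k -> odd k ->
    procedure_output p q false 1.

End FunctionField.

Arguments full_constant_field : clear implicits.

(* Main.v *)
Require Import Defs.
From HB Require Import structures.
From mathcomp Require Import all_boot all_order all_algebra all_field.
From mathcomp Require Import boolp classical_sets freeg.
From mathcomp Require Import zify ring.

Set Implicit Arguments.
Unset Strict Implicit.
Unset Printing Implicit Defensive.

Import Order.TTheory GRing.Theory Num.Theory.

Local Open Scope ring_scope.

(* If z is a nonzero section of k p - k q with deg p = deg q, then z has divisor
   exactly k q - k p, because a divisor of negative degree has no nonzero section;
   for even k this makes z singular. Two such sections differ by a factor without
   zeros and poles, which is constant, so the Riemann-Roch space is the line F z.
   For the existence of k, Riemann's inequality gives nonzero sections x_i of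
   (N + i) p - i q for all i. The divisors of zeros left over are effective of
   fixed degree, hence finitely many, and a quotient x_i' / x_i of two with the
   same leftover is a section of (i' - i) (p - q).

   Places are only given as abstract valuations, so that "no poles implies
   constant" rests on constructing a place at which a given transcendental w
   vanishes: a subalgebra maximal among those containing w but not 1/w is a
   valuation ring, and it is discrete because chains of divisors have bounded
   length. All bounds come from one principle: elements of a subalgebra O that
   are F-independent modulo x O are F[x]-independent, and the number of
   F[x]-independent elements of K is bounded. *)

(** * Constants and linear algebra over F modulo a subspace *)

Section Constants.
Variables (F : finFieldType) (K : fieldExtType {fraction {poly F}}).

Fact constf_is_zmod_morphism : zmod_morphism (@constf F K).
Proof. by move=> a b; rewrite /constf polyCB tofracB scalerBl. Qed.

Fact constf_is_monoid_morphism : monoid_morphism (@constf F K).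
Proof.
split=> [|a b]; rewrite /constf; first by rewrite polyC1 tofrac1 scale1r.
by rewrite polyCM tofracM -scalerAl mul1r scalerA.
Qed.

HB.instance Definition _ :=
  GRing.isZmodMorphism.Build F K (@constf F K) constf_is_zmod_morphism.
HB.instance Definition _ :=
  GRing.isMonoidMorphism.Build F K (@constf F K) constf_is_monoid_morphism.

Definition evalf (x : K) (h : {poly F}) : K := (map_poly (constf K) h).[x].

Lemma evalf0 x : evalf x 0 = 0. Proof. by rewrite /evalf rmorph0 horner0. Qed.
Lemma evalfC x c : evalf x c%:P = constf K c.
Proof. by rewrite /evalf map_polyC hornerC. Qed.
Lemma evalfD x g h : evalf x (g + h) = evalf x g + evalf x h.
Proof. by rewrite /evalf rmorphD hornerD. Qed.
Lemma evalfM x g h : evalf x (g * h) = evalf x g * evalf x h.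
Proof. by rewrite /evalf rmorphM hornerM. Qed.
Lemma evalfX x : evalf x 'X = x.
Proof. by rewrite /evalf map_polyX hornerX. Qed.
Lemma evalf_coef x n (h : {poly F}) : (size h <= n)%N ->
  evalf x h = \sum_(i < n) constf K h`_i * x ^+ i.
Proof.
move=> hn; rewrite /evalf (@horner_coef_wide _ n) ?size_map_poly //.
by apply: eq_bigr => i _; rewrite coef_map.
Qed.

Definition subspace (V : set K) : Prop :=
  V 0 /\ forall c x y, V x -> V y -> V (constf K c * x + y).

Lemma subspaceD V x y : subspace V -> V x -> V y -> V (x + y).
Proof. by move=> [_ h] Vx Vy; rewrite -[x]mul1r -(rmorph1 (constf K)); apply: h. Qed.
Lemma subspaceZ V c x : subspace V -> V x -> V (constf K c * x).
Proof. by move=> [V0 h] Vx; rewrite -[_ * _]addr0; apply: h. Qed.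
Lemma subspaceN V x : subspace V -> V x -> V (- x).
Proof. by move=> sV Vx; rewrite -mulN1r -(rmorphN1 (constf K)); apply: subspaceZ. Qed.
Lemma subspaceB V x y : subspace V -> V x -> V y -> V (x - y).
Proof. by move=> sV Vx Vy; apply: subspaceD => //; apply: subspaceN. Qed.
Lemma subspace_sum V (I : finType) (f : I -> K) :
  subspace V -> (forall i, V (f i)) -> V (\sum_i f i).
Proof.
move=> sV h; apply: big_ind => //; first by case: sV.
by move=> x y; apply: subspaceD.
Qed.

Definition lincomb n (b : 'I_n -> K) (c : 'rV[F]_n) : K :=
  \sum_(i < n) constf K (c 0 i) * b i.

Lemma lincomb0 n (b : 'I_n -> K) : lincomb b 0 = 0.
Proof. by apply: big1 => i _; rewrite mxE rmorph0 mul0r. Qed.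
Lemma lincombB n (b : 'I_n -> K) c d : lincomb b (c - d) = lincomb b c - lincomb b d.
Proof.
rewrite -sumrB; apply: eq_bigr => i _.
by rewrite !mxE rmorphB mulrBl.
Qed.
Lemma lincomb_sub V n (b : 'I_n -> K) c :
  subspace V -> (forall i, V (b i)) -> V (lincomb b c).
Proof. by move=> sV h; apply: subspace_sum => // i; apply: subspaceZ. Qed.

Definition join n m (b : 'I_n -> K) (b' : 'I_m -> K) (i : 'I_(n + m)) : K :=
  match split i with inl j => b j | inr j => b' j end.

Lemma lincomb_join n m (b : 'I_n -> K) (b' : 'I_m -> K) c c' :
  lincomb (join b b') (row_mx c c') = lincomb b c + lincomb b' c'.
Proof.
rewrite /lincomb big_split_ord /=; congr (_ + _); apply: eq_bigr => i _;
  rewrite ?row_mxEl ?row_mxEr /join.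
- by rewrite (unsplitK (inl _ i)).
- by rewrite (unsplitK (inr _ i)).
Qed.

Definition indep_mod (V W : set K) n (b : 'I_n -> K) : Prop :=
  (forall i, V (b i)) /\ forall c, W (lincomb b c) -> c = 0.

Definition span_mod (V W : set K) n (b : 'I_n -> K) : Prop :=
  (forall i, V (b i)) /\ forall x, V x -> exists c, W (x - lincomb b c).

Lemma indep_mod_trans V W U n m (b : 'I_n -> K) (b' : 'I_m -> K) :
    subspace W -> (forall x, W x -> V x) -> (forall x, U x -> W x) ->
    indep_mod V W b -> indep_mod W U b' -> indep_mod V U (join b b').
Proof.
move=> sW WV UW [Vb ib] [Wb ib']; split=> [i|c].
  by rewrite /join; case: split => j //; apply: WV.
rewrite -(hsubmxK c) lincomb_join => hU.
have b'W : W (lincomb b' (rsubmx c)) by apply: lincomb_sub.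
have c1 : lsubmx c = 0.
  by apply: ib; rewrite -(addrK (lincomb b' (rsubmx c)) (lincomb b _)); apply: subspaceB => //; apply: UW.
move: hU; rewrite c1 lincomb0 add0r => /ib' ->.
by rewrite row_mx0.
Qed.

Lemma span_mod_trans V W U n m (b : 'I_n -> K) (b' : 'I_m -> K) :
    (forall x, W x -> V x) ->
    span_mod V W b -> span_mod W U b' -> span_mod V U (join b b').
Proof.
move=> WV [Vb sb] [Wb sb']; split=> [i|x /sb [c /sb' [c' h]]].
  by rewrite /join; case: split => j //; apply: WV.
by exists (row_mx c c'); rewrite lincomb_join opprD addrA.
Qed.

Definition basis_mod (V W : set K) n (b : 'I_n -> K) : Prop :=
  indep_mod V W b /\ span_mod V W b.

Lemma is_basis_modP V W n (b : n.-tuple K) : subspace W ->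
  is_basis_mod V W b <-> basis_mod V W (tnth b).
Proof.
move=> sW; split=> [[Vb h]|[[Vb ib] [_ sb]]]; last first.
  split=> // x /sb [c hc]; exists c; split=> // d hd.
  apply/eqP; rewrite -subr_eq0; apply/eqP/ib.
  rewrite lincombB.
  have -> : lincomb (tnth b) c - lincomb (tnth b) d =
    (x - lincomb (tnth b) d) - (x - lincomb (tnth b) c) by ring.
  exact: subspaceB.
do !split=> //; last by move=> x /h [c [hc _]]; exists c.
move=> c hc.
case: n b Vb h c hc => [|n] b Vb h c hc; first by rewrite thinmx0.
(* If the combination with coefficients [c] lies in W, then [e] and [e - c] are both coordinates of
   b_0 in V, and uniqueness gives c = 0. *)
have [d [_ hd]] := h _ (Vb ord0).
pose e : 'rV[F]_n.+1 := delta_mx 0 ord0.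
have he : lincomb (tnth b) e = tnth b ord0.
  rewrite /lincomb (bigD1 ord0) //= mxE !eqxx rmorph1 mul1r big1 ?addr0 // => i ni.
  by rewrite mxE (negPf ni) andbF rmorph0 mul0r.
have d1 : d = e.
  apply: hd; rewrite -/(lincomb _ _) he subrr; by case: sW.
have d2 : d = e - c.
  apply: hd; rewrite -/(lincomb _ _) lincombB he opprB addrC subrK //.
by apply: oppr_inj; apply: (addrI e); rewrite oppr0 addr0 -d2 d1.
Qed.

End Constants.

(** * Bounding the number of F[x]-independent elements of K *)

Section RankBound.
Variables (F : finFieldType) (K : fieldExtType {fraction {poly F}}).
Implicit Types (V W : set K) (x y z : K) (g h : {poly F}).

Let sum_enum_val (I : finType) (f : I -> K) :
  \sum_i f i = \sum_(k < #|I|) f (enum_val k).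
Proof. exact: (reindex _ (onW_bij _ (@enum_val_bij I))). Qed.

Lemma span_mod_enum V W (I : finType) (b : I -> K) :
    (forall i, V (b i)) ->
    (forall x, V x -> exists c : I -> F, W (x - \sum_i constf K (c i) * b i)) ->
  span_mod V W (fun i : 'I_#|I| => b (enum_val i)).
Proof.
move=> Vb sb; split=> // x /sb [c hc].
exists (\row_i c (enum_val i)).
suff -> : lincomb (fun i : 'I_#|I| => b (enum_val i)) (\row_i c (enum_val i)) =
          \sum_i constf K (c i) * b i by [].
rewrite [RHS]sum_enum_val /lincomb.
by apply: eq_bigr => i _; rewrite mxE.
Qed.

(** The coordinate matrix of v with respect to B has more rows than columns, and a nonzero row in
    its left kernel is the relation. Both dimension counts of the development end here. *)
Lemma span_mod_dependent V W m (B : 'I_m -> K) (I : finType) (v : I -> K) :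
    subspace W -> span_mod V W B -> (forall i, V (v i)) -> (m < #|I|)%N ->
  exists c : I -> F, (exists i, c i != 0) /\ W (\sum_i constf K (c i) * v i).
Proof.
move=> sW [_ sB] Vv mI.
have [d hd] := choice (fun i => sB _ (Vv i)).
pose A : 'M[F]_(#|I|, m) := \matrix_(i, j) d (enum_val i) 0 j.
have : kermx A != 0.
  rewrite kermx_eq0 /row_free; apply: contraL mI => /eqP rA.
  by rewrite -leqNgt -rA rank_leq_col.
case/rowV0Pn=> u /sub_kermxP uA u0.
exists (fun i => u 0 (enum_rank i)); split.
  move/rV0Pn: u0 => [j uj]; exists (enum_val j); by rewrite enum_valK.
have -> : \sum_i constf K (u 0 (enum_rank i)) * v i =
  \sum_i constf K (u 0 (enum_rank i)) * (v i - lincomb B (d i)).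
  rewrite -[RHS](addrK (\sum_i constf K (u 0 (enum_rank i)) * lincomb B (d i))).
  rewrite -big_split /= [X in _ - X](_ : _ = 0) ?subr0.
    by apply: eq_bigr => i _; rewrite -mulrDr subrK.
  under eq_bigr do rewrite mulr_sumr.
  rewrite exchange_big /= big1 // => j _.
  have : (u *m A) 0 j = 0 by rewrite uA mxE.
  rewrite mxE => /(congr1 (constf K)); rewrite rmorph0 rmorph_sum => h.
  rewrite -[RHS](mul0r (B j)) -[X in _ = X * _]h mulr_suml.
  rewrite [LHS]sum_enum_val.
  by apply: eq_bigr => i _; rewrite mxE rmorphM mulrA enum_valK.
by apply: subspace_sum => // i; apply: subspaceZ.
Qed.

Definition poly_indep x n (z : 'I_n -> K) : Prop :=
  forall h : 'I_n -> {poly F},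
    \sum_(i < n) evalf x (h i) * z i = 0 -> forall i, h i = 0.

(** The embedding of F[t], with t the variable of the base field; [evalf], by contrast, substitutes
    an arbitrary element of K. *)
Let ratf (g : {poly F}) : K := (tofrac g)%:A.

Let ratfM g h : ratf (g * h) = ratf g * ratf h.
Proof. by rewrite /ratf tofracM -scalerAl mul1r scalerA. Qed.
Let ratfD g h : ratf (g + h) = ratf g + ratf h.
Proof. by rewrite /ratf tofracD scalerDl. Qed.
Let ratfE g z : ratf g * z = tofrac g *: z.
Proof. by rewrite /ratf -scalerAl mul1r. Qed.
Let ratf_eq0 g : (ratf g == 0) = (g == 0).
Proof. by rewrite /ratf scaler_eq0 oner_eq0 orbF tofrac_eq0. Qed.

Let d : nat := \dim {: K}.
Let e (k : 'I_d) : K := (vbasis {: K})`_k.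

(** A box for counting: [lam D] has dimension at most [d * D] over F, and every element of K enters
    some box once its denominators are cleared. *)
Let lam D : set K := fun z =>
  exists P : 'I_d -> {poly F}, (forall k, (size (P k) <= D)%N) /\
     z = \sum_k ratf (P k) * e k.

Let lam_mono D D' z : (D <= D')%N -> lam D z -> lam D' z.
Proof. by move=> DD [P [sP ->]]; exists P; split=> // k; apply: leq_trans DD. Qed.

Let lam_sum D (I : finType) (f : I -> K) : (forall i, lam D (f i)) -> lam D (\sum_i f i).
Proof.
move=> h; apply: (big_ind (lam D)) => //.
  exists (fun=> 0); split=> [k|]; first by rewrite size_poly0.
  by rewrite big1 // => k _; rewrite /ratf tofrac0 scale0r mul0r.
move=> _ _ [P [sP ->]] [Q [sQ ->]]; exists (fun k => P k + Q k); split=> [k|].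
  by apply: (leq_trans (size_polyD _ _)); rewrite geq_max sP sQ.
by rewrite -big_split; apply: eq_bigr => k _; rewrite ratfD mulrDl.
Qed.

Let lamM D g z D' : (size g <= D')%N -> lam D z -> lam (D + D') (ratf g * z).
Proof.
move=> sg [P [sP ->]]; exists (fun k => g * P k); split=> [k|].
  have := size_polyMleq g (P k); have := sP k; lia.
by rewrite mulr_sumr; apply: eq_bigr => k _; rewrite ratfM mulrA.
Qed.

Let lam_denom z : exists g D, g != 0 /\ lam D (ratf g * z).
Proof.
have fr (q : {fraction {poly F}}) : exists nd : {poly F} * {poly F},
    nd.2 != 0 /\ tofrac nd.2 * q = tofrac nd.1.
  elim/quotW: q => r; exists (fraction.frac r); split; first exact: denom_ratioP.
  unlock tofrac; rewrite -[LHS]FracField.pi_mul.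
  apply/eqmodP; rewrite /= FracField.equivfE /FracField.mulf.
  by rewrite !numden_Ratio ?(oner_eq0, mulf_neq0, denom_ratioP) // mul1r !mulr1 mulrC.
have [nd hnd] := choice (fun k : 'I_d => fr (coord (vbasis {: K}) k z)).
pose Q k := (\prod_(l | l != k) (nd l).2) * (nd k).1.
exists (\prod_k (nd k).2), (\max_k size (Q k)); split.
  by apply/prodf_neq0 => k _; case: (hnd k).
exists Q; split=> [k|]; first exact: (leq_bigmax k).
rewrite {1}(coord_vbasis (memvf z)) mulr_sumr; apply: eq_bigr => k _.
have hk : ratf (nd k).2 * (coord (vbasis {: K}) k z *: e k) = ratf (nd k).1 * e k.
  by have [_ h] := hnd k; rewrite !ratfE scalerA h.
by rewrite (bigD1 k) //= /Q !ratfM [ratf _ * ratf _]mulrC -!mulrA hk.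
Qed.

Let lam_denoms (I : finType) (z : I -> K) :
  exists g D, g != 0 /\ forall i, lam D (ratf g * z i).
Proof.
have h i : exists gD : {poly F} * nat, gD.1 != 0 /\ lam gD.2 (ratf gD.1 * z i).
  by have [g [D h]] := lam_denom (z i); exists (g, D).
have [f hf] := choice h.
exists (\prod_i (f i).1),
  (\max_i ((f i).2 + size (\prod_(j | j != i) (f j).1)%R))%N; split.
  by apply/prodf_neq0 => i _; case: (hf i).
move=> i; rewrite [X in ratf X](bigD1 i) //= ratfM [ratf _ * ratf _]mulrC -mulrA.
apply: lam_mono (leq_bigmax i) _.
by apply: lamM => //; case: (hf i).
Qed.

Let lam_span D : exists B : 'I_(d * D) -> K, span_mod (lam D) [set 0]%classic B.
Proof.
pose b (kj : 'I_d * 'I_D) : K := ratf 'X^(nat_of_ord kj.2) * e kj.1.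
have : span_mod (lam D) [set 0]%classic (fun i : 'I_#|{: 'I_d * 'I_D}| => b (enum_val i)).
  apply: (@span_mod_enum _ _ _ b) => [[k j]|z [P [sP ->]]].
    exists (fun l => if l == k then 'X^j else 0); split=> [l|].
      by case: eqP; rewrite ?size_poly0 // size_polyXn.
    rewrite (bigD1 k) //= eqxx big1 ?addr0 // => l /negPf ->.
    by rewrite /ratf tofrac0 scale0r mul0r.
  exists (fun kj : 'I_d * 'I_D => (P kj.1)`_(nat_of_ord kj.2)).
  have -> : \sum_kj constf K (P kj.1)`_(nat_of_ord kj.2) * b kj =
      \sum_k \sum_(j < D) constf K (P k)`_j * (ratf 'X^j * e k).
    by rewrite pair_bigA.
  apply/eqP; rewrite subr_eq0; apply/eqP; apply: eq_bigr => k _.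
  under eq_bigr do rewrite mulrA.
  rewrite -mulr_suml; congr (_ * _).
  have {1}-> : P k = \sum_(j < D) ((P k)`_j)%:P * 'X^j.
    rewrite -[LHS](coefK) poly_def.
    rewrite (big_ord_widen D (fun j => (P k)`_j *: 'X^j)) // big_mkcond /=.
    apply: eq_bigr => j _; rewrite mul_polyC; case: ltnP => // h.
    by rewrite nth_default // scale0r.
  have -> : ratf (\sum_(j < D) ((P k)`_j)%:P * 'X^j) = \sum_(j < D) ratf (((P k)`_j)%:P * 'X^j).
    elim/big_rec2: _ => [|j y1 y2 _ <-]; last exact: ratfD.
    by rewrite /ratf tofrac0 scale0r.
  by apply: eq_bigr => j _; rewrite ratfM.
have <- : #|{: 'I_d * 'I_D}| = (d * D)%N by rewrite card_prod !card_ord.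
by move=> h; exists (fun i => b (enum_val i)); exact: h.
Qed.

(** Take for g a common denominator of the products x e_k. The shift c does not depend on D, so m
    successive multiplications by g or g x cost m c in total. *)
Let lam_mulx x : exists g c, g != 0 /\ forall D z, lam D z ->
  lam (D + c) (ratf g * z) /\ lam (D + c) (ratf g * x * z).
Proof.
have [g [c [g0 h]]] := lam_denoms (fun k => x * e k).
exists g, (maxn c (size g)); split=> // D z lz; split.
  by apply: lamM => //; rewrite leq_maxr.
case: lz => P [sP ->]; rewrite mulr_sumr; apply: lam_sum => k.
rewrite mulrCA -mulrA addnC; apply: lamM => //.
by apply: lam_mono (h k); rewrite leq_maxl.
Qed.

(* Multiplication by x^a raises the degrees of the coordinates over F(t) by at
   most a * c, so too many F[x]-independent elements would outnumber the
   dimension of the space of elements with coordinates of bounded degree. *)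
Lemma poly_indep_bound x : exists N, forall n (z : 'I_n -> K),
  poly_indep x z -> (n <= N)%N.
Proof.
have [g [c [g0 hg]]] := lam_mulx x.
exists (d * c)%N => n z iz; rewrite leqNgt; apply/negP => nN.
have [g1 [c1 [g10 hg1]]] := lam_denoms z.
(* For n > d c there are at least (d c + 1)(A + 1) products x^a z_i with a <= A; for A = d c1 this
   exceeds the dimension bound d (c1 + A c) of the box that contains them after scaling. *)
pose A := (d * c1)%N.
pose v (ia : 'I_n * 'I_A.+1) := ratf g ^+ A * ratf g1 * (x ^+ ia.2 * z ia.1).
have lv (m a : nat) i : (a <= m)%N ->
  lam (c1 + m * c) (ratf g ^+ m * ratf g1 * (x ^+ a * z i)).
  elim: m a => [|m IH] [|a] // am.
  - by rewrite mul0n addn0 !expr0 !mul1r; apply: hg1.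
  - have [h _] := hg _ _ (IH 0%N isT).
    have -> : (c1 + m.+1 * c = c1 + m * c + c)%N by lia.
    by rewrite exprS -!mulrA; rewrite -!mulrA in h.
  - have [_ h] := hg _ _ (IH a am).
    have -> : (c1 + m.+1 * c = c1 + m * c + c)%N by lia.
    suff -> : ratf g ^+ m.+1 * ratf g1 * (x ^+ a.+1 * z i) =
      ratf g * x * (ratf g ^+ m * ratf g1 * (x ^+ a * z i)) by [].
    by rewrite !exprS; ring.
have [B sB] := lam_span (c1 + A * c).
have lvi ia : lam (c1 + A * c) (v ia) by apply: lv; rewrite -ltnS.
have s0 : subspace [set (0 : K)]%classic.
  by split=> // a y1 y2 -> ->; rewrite mulr0 addr0.
have card : (d * (c1 + A * c) < #|{: 'I_n * 'I_A.+1}|)%N.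
  by rewrite card_prod !card_ord /A; nia.
have [f [[[i a] fia] /= hf]] := span_mod_dependent s0 sB lvi card.
pose h (i : 'I_n) : {poly F} := \poly_(a < A.+1) f (i, inord a).
suff h0 : h i = 0.
  move/eqP: fia; apply; have := coef_poly A.+1 (fun a => f (i, inord a)) a.
  by rewrite -/(h i) h0 coef0 ltn_ord inord_val.
apply: iz.
have gg : ratf g ^+ A * ratf g1 != 0.
  by rewrite mulf_neq0 ?expf_neq0 ?ratf_eq0.
apply: (mulfI gg); rewrite mulr0 -[RHS]hf mulr_sumr.
have -> : \sum_ia constf K (f ia) * v ia =
    \sum_i \sum_(a < A.+1) constf K (f (i, a)) * v (i, a).
  by rewrite pair_bigA; apply: eq_bigr => -[].
apply: eq_bigr => j _.
rewrite (@evalf_coef _ _ _ A.+1) ?size_poly // mulr_suml mulr_sumr.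
apply: eq_bigr => b _; rewrite coef_poly ltn_ord inord_val /v /=.
set u := ratf g ^+ A; set w := ratf g1; set t := constf K _; set y := x ^+ _.
by ring.
Qed.

End RankBound.

(** * Subalgebras O of K and the quotients O / x O *)

Section Subalgebras.
Variables (F : finFieldType) (K : fieldExtType {fraction {poly F}}).
Implicit Types (O : set K) (x y z : K) (g h : {poly F}).

Definition subalgebra O : Prop :=
  [/\ forall c, O (constf K c), forall x y, O x -> O y -> O (x + y)
    & forall x y, O x -> O y -> O (x * y)].

Lemma subalgebra0 O : subalgebra O -> O 0.
Proof. by case=> /(_ 0) + _ _; rewrite rmorph0. Qed.
Lemma subalgebra1 O : subalgebra O -> O 1.
Proof. by case=> /(_ 1) + _ _; rewrite rmorph1. Qed.
Lemma subalgebraN O x : subalgebra O -> O x -> O (- x).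
Proof.
by case=> hc _ hM Ox; rewrite -mulN1r -(rmorphN1 (constf K)); apply: hM Ox; apply: hc.
Qed.
Lemma subalgebra_subspace O : subalgebra O -> subspace O.
Proof.
move=> aO; split; first exact: subalgebra0.
by case: aO => hc hD hM c x y Ox Oy; apply: hD => //; apply: hM.
Qed.
Lemma subalgebraX O x n : subalgebra O -> O x -> O (x ^+ n).
Proof.
move=> aO Ox; elim: n => [|n IH]; first by rewrite expr0; apply: subalgebra1.
by rewrite exprS; case: aO => _ _; apply.
Qed.
Lemma subalgebra_evalf O x h : subalgebra O -> O x -> O (evalf x h).
Proof.
move=> aO Ox; rewrite (evalf_coef x (leqnn _)).
apply: subspace_sum; first exact: subalgebra_subspace.
by move=> i; case: (aO) => hc _; apply => //; apply: subalgebraX.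
Qed.

(** For nonzero x this is the ideal x O, encoded by division so that membership needs no witness. *)
Definition multiples x O : set K := fun w => O (w / x).

Lemma multiples_subspace x O : subalgebra O -> subspace (multiples x O).
Proof.
move=> /subalgebra_subspace [O0 h]; split; first by rewrite /multiples mul0r.
by move=> c y z Oy Oz; rewrite /multiples mulrDl -mulrA; apply: h.
Qed.

(** In a relation with coefficients h_i(x), the constant terms of the h_i give a combination of the
    z_i in x O, hence vanish; divide the relation by x and induct on the degree. *)
Lemma indep_mod_poly_indep O x n (z : 'I_n -> K) :
  subalgebra O -> O x -> x != 0 -> indep_mod O (multiples x O) z -> poly_indep x z.
Proof.
move=> aO Ox x0 [Oz iz] h; move: {2}(\max_i size (h i)) (leqnn (\max_i size (h i))) => D hm.
have {hm} hD i : (size (h i) <= D)%N by apply: leq_trans hm; apply: (leq_bigmax i).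
elim: D h hD => [|D IH] h hD hs i.
  by apply/eqP; rewrite -size_poly_eq0 -leqn0.
pose h' i := \poly_(k < D) (h i)`_k.+1.
have hE j : h j = h' j * 'X + ((h j)`_0)%:P.
  apply/polyP=> k; rewrite coefD coefMX coefC coef_poly.
  case: k => [|k] /=; rewrite ?add0r ?addr0 //; case: ltnP => // Dk.
  by rewrite nth_default //; apply: leq_trans (hD j) _.
have eE j : evalf x (h j) = evalf x (h' j) * x + constf K (h j)`_0.
  by rewrite {1}hE evalfD evalfM evalfX evalfC.
pose c : 'rV[F]_n := \row_j (h j)`_0.
have lE : lincomb z c = - (\sum_j evalf x (h' j) * z j) * x.
  rewrite mulNr; apply/eqP; rewrite -addr_eq0; apply/eqP.
  rewrite -[RHS]hs mulr_suml -big_split; apply: eq_bigr => j _.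
  by rewrite mxE eE /=; ring.
have aOs := subalgebra_subspace aO.
have Os : O (\sum_j evalf x (h' j) * z j).
  apply: subspace_sum => // j; case: (aO) => _ _; apply => //.
  exact: subalgebra_evalf.
have c0 : c = 0.
  by apply: iz; rewrite /multiples lE mulfK //; apply: subalgebraN.
have h0 j : (h j)`_0 = 0.
  by have := congr1 (fun c : 'rV_n => c 0 j) c0; rewrite !mxE.
have s0 : \sum_j evalf x (h' j) * z j = 0.
  move/eqP: lE; rewrite c0 lincomb0 eq_sym mulf_eq0 oppr_eq0 (negPf x0) orbF.
  by move/eqP.
have h'0 := IH h' (fun j => size_poly _ _) s0.
by rewrite hE h'0 mul0r h0 add0r.
Qed.

(** Finiteness of O / x O over F. It bounds chains of divisors in a valuation ring and makes residue
    fields finite. *)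
Lemma indep_mod_bound O x : subalgebra O -> O x -> x != 0 ->
  exists N, forall n (z : 'I_n -> K), indep_mod O (multiples x O) z -> (n <= N)%N.
Proof.
move=> aO Ox x0; have [N hN] := poly_indep_bound x.
by exists N => n z iz; apply: hN; apply: indep_mod_poly_indep iz.
Qed.

End Subalgebras.

(** * From a valuation ring of K to a normalized discrete valuation *)

Section PlaceOfValuationRing.
Variables (F : finFieldType) (K : fieldExtType {fraction {poly F}}).
Variables (O : set K) (aO : subalgebra O).
Hypothesis valO : forall y, O y \/ O y^-1.
Variable w : K.
Hypotheses (Ow : O w) (OVw : ~ O w^-1).
Implicit Types (x y z : K).

Let OM x y : O x -> O y -> O (x * y). Proof. by case: aO => _ _; apply. Qed.
Let OD x y : O x -> O y -> O (x + y). Proof. by case: aO => _ + _; apply. Qed.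
Let O0 : O 0. Proof. exact: subalgebra0. Qed.
Let O1 : O 1. Proof. exact: subalgebra1. Qed.

(** The maximal ideal of O without 0: as 0^-1 = 0, the second condition excludes 0. *)
Let M z := O z /\ ~ O z^-1.

Let M_neq0 z : M z -> z != 0.
Proof. by case=> _ nz; apply: contra_not_neq nz => ->; rewrite invr0. Qed.

Let MM x y : y != 0 -> M x -> O y -> M (x * y).
Proof.
move=> y0 [Ox nx] Oy; split; first exact: OM.
move=> h; apply: nx; suff -> : x^-1 = (x * y)^-1 * y by apply: OM.
by rewrite invfM -mulrA mulVf // mulr1.
Qed.

(** Encodes a strictly increasing chain z O < z' O < ... of n further principal ideals, all
    proper. *)
Let Fixpoint chain n z : Prop :=
  if n is n'.+1 then exists z', [/\ M z', M (z / z') & chain n' z'] else True.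

(** Each step z O < z' O contributes the class of z', which is nonzero modulo z O because z / z' is
    not a unit. *)
Let chain_indep n z : O z -> z != 0 -> chain n z ->
  exists b : 'I_n -> K, indep_mod O (multiples z O) b.
Proof.
elim: n z => [|n IH] z Oz z0 /=.
  by move=> _; exists (fun=> 0); split=> [[]//|c _]; rewrite thinmx0.
case=> z' [Mz' [Mzz nMzz] /IH]; case=> [||b ib]; first by case: Mz'.
  exact: M_neq0.
rewrite -addn1; exists (join b (fun=> z')); apply: (@indep_mod_trans _ _ _ (multiples z' O)) => //.
- exact: multiples_subspace.
- by move=> y yz; rewrite -[y](divfK (M_neq0 Mz')); apply: OM yz _; case: Mz'.
- move=> y yz; rewrite /multiples.
  have -> : y / z' = (y / z) * (z / z') by rewrite mulrA divfK.
  exact: OM yz _.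
- split=> [i|c]; first by rewrite /multiples divff // M_neq0.
  rewrite /lincomb big_ord1 => h.
  suff c0 : c 0 ord0 = 0 by apply/rowP => i; rewrite ord1 c0 mxE.
  apply: contrapT => /eqP c0; apply: nMzz; rewrite invf_div.
  have -> : z' / z = constf K (c 0 ord0)^-1 * (constf K (c 0 ord0) * z' / z).
    by rewrite !mulrA -rmorphM mulVf // rmorph1 mul1r.
  by apply: OM => //; case: aO.
Qed.

Let chain_bound z : O z -> z != 0 -> exists N, forall n, chain n z -> (n <= N)%N.
Proof.
move=> Oz z0; have [N hN] := indep_mod_bound aO Oz z0.
by exists N => n /(chain_indep Oz z0) [b ib]; apply: hN ib.
Qed.

(** If no element of M divides all the others, then by [valO] every z in M has a proper divisor in
    M, and chains of any length start at w. *)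
Let exists_uniformizer : exists pi, M pi /\ forall z, M z -> O (z / pi).
Proof.
apply: contrapT => no.
have step z : M z -> exists z', M z' /\ M (z / z').
  move=> Mz; apply: contrapT => noz; apply: no; exists z; split=> // z' Mz'.
  apply: contrapT => nO; apply: noz; exists z'; split=> //.
  have [//|h] := valO (z' / z).
  by move: h; rewrite invf_div => h; split=> //; rewrite invf_div.
have all_chain n : forall z, M z -> chain n z.
  elim: n => [|n IH] z Mz //=; have [z' [Mz' Mzz]] := step z Mz.
  by exists z'; split=> //; apply: IH.
have Mw : M w by [].
have [N hN] := chain_bound Ow (M_neq0 Mw).
by have := hN N.+1 (all_chain _ _ Mw); rewrite ltnn.
Qed.

Let pi := projT1 (cid exists_uniformizer).
Let Mpi : M pi. Proof. exact: (projT2 (cid exists_uniformizer)).1. Qed.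
Let piP z : M z -> O (z / pi).
Proof. exact: (projT2 (cid exists_uniformizer)).2. Qed.
Let pi0 : pi != 0. Proof. exact: M_neq0. Qed.
Let Opi : O pi. Proof. by case: Mpi. Qed.
Let nOpi : ~ O pi^-1. Proof. by case: Mpi. Qed.

Let vunit u := [/\ u != 0, O u & O u^-1].

Let chain_pi n : chain n (pi ^+ n.+1).
Proof.
elim: n => [|n IH] //=; exists (pi ^+ n.+1); split=> //.
  by rewrite exprS; apply: MM => //; rewrite ?expf_neq0 //; apply: subalgebraX.
by rewrite [X in M (X / _)]exprS mulfK ?expf_neq0.
Qed.

(** Otherwise z / pi^k is a nonunit of O for every k, and the powers of [pi] form chains of
    unbounded length above z O. *)
Let decomp_int z : z != 0 -> O z -> exists k : nat, vunit (z / pi ^+ k).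
Proof.
move=> z0 Oz; apply: contrapT => no.
have ok k : O (z / pi ^+ k) -> M (z / pi ^+ k).
  move=> h; split=> // h'; apply: no; exists k; split=> //.
  by rewrite mulf_neq0 ?invr_eq0 ?expf_neq0.
have hk k : M (z / pi ^+ k).
  elim: k => [|k IH]; apply: ok; first by rewrite expr0 divr1.
  by rewrite exprSr invfM mulrA; apply: piP.
have [N hN] := chain_bound Oz z0.
have : chain N.+1 z.
  exists (pi ^+ N.+1); split=> //.
  by rewrite exprS; apply: MM => //; rewrite ?expf_neq0 //; apply: subalgebraX.
by move/hN; rewrite ltnn.
Qed.

Let vunitV u : vunit u -> vunit u^-1.
Proof. by case=> u0 Ou OVu; split; rewrite ?invr_eq0 ?invrK. Qed.

Let vunitM u v : vunit u -> vunit v -> vunit (u * v).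
Proof.
move=> [u0 Ou OVu] [v0 Ov OVv].
by split; rewrite ?invfM ?mulf_neq0 //; apply: OM.
Qed.

Let decomp z : z != 0 -> exists k : int, vunit (z / pi ^ k).
Proof.
move=> z0; have [Oz|Oz] := valO z.
  by have [k h] := decomp_int z0 Oz; exists k%:Z.
have [k h] := decomp_int (invr_neq0 z0) Oz; exists (- k%:Z).
by rewrite -invr_expz invrK -[z * _]invrK invfM; apply: vunitV.
Qed.

Let O_pi_exp (n : int) : O (pi ^ n) -> 0 <= n.
Proof.
case: n => // n h; exfalso; apply: nOpi.
have -> : pi^-1 = pi ^ (Negz n) * pi ^+ n.
  by rewrite NegzE -exprnN exprS invfM -mulrA mulVf ?expf_neq0 // mulr1.
by apply: OM => //; apply: subalgebraX.
Qed.

(** The value at 0 is the one that [place] prescribes; for z != 0 the default of [xget] is never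
    reached, by [decomp]. *)
Let val z : int := if z == 0 then 0 else xget 0 [set k | vunit (z / pi ^ k)]%classic.

Let valP z : z != 0 -> vunit (z / pi ^ (val z)).
Proof.
move=> z0; rewrite /val (negPf z0).
exact: (xgetPex 0 (decomp z0)).
Qed.

Let val_ge0 z : z != 0 -> O z <-> 0 <= val z.
Proof.
move=> z0; have [u0 Ou OVu] := valP z0; have hz := divfK (expfz_neq0 (val z) pi0) z.
split=> [Oz|].
  apply: O_pi_exp; have -> : pi ^ val z = z * (z / pi ^ val z)^-1.
    by rewrite invf_div mulrCA mulfV // mulr1.
  exact: OM.
case: (val z) Ou hz => // n Ou <- _; apply: OM => //; exact: subalgebraX.
Qed.

Let val_uniq z k : z != 0 -> vunit (z / pi ^ k) -> val z = k.
Proof.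
have le m n : z != 0 -> vunit (z / pi ^ m) -> vunit (z / pi ^ n) -> n <= m.
  move=> z0 h1 h2; rewrite -subr_ge0; apply: O_pi_exp.
  have -> : pi ^ (m - n) = (z / pi ^ n) * (z / pi ^ m)^-1.
    by rewrite expfzDr // invf_div -invr_expz -[LHS]mulr1 -(mulfV z0); ring.
  by have [] := vunitM h2 (vunitV h1).
move=> z0 h; apply/eqP; rewrite eq_le !le //; exact: valP.
Qed.

Let valM x y : x != 0 -> y != 0 -> val (x * y) = val x + val y.
Proof.
move=> x0 y0; apply: val_uniq; first by rewrite mulf_neq0.
have -> : x * y / pi ^ (val x + val y) = (x / pi ^ val x) * (y / pi ^ val y).
  by rewrite expfzDr // invfM; ring.
by apply: vunitM; apply: valP.
Qed.

Let val_pi (k : int) : val (pi ^ k) = k.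
Proof.
apply: val_uniq; rewrite ?divff ?expfz_neq0 //.
by split; rewrite ?invr1 ?oner_neq0.
Qed.

(** After division by pi^m this is closure of O under addition. *)
Let valD x y : x != 0 -> y != 0 -> x + y != 0 ->
  Num.min (val x) (val y) <= val (x + y).
Proof.
move=> x0 y0 xy0; set m := Num.min _ _.
have hp : pi ^ (- m) != 0 by rewrite expfz_neq0.
have ge z : z != 0 -> O (z * pi ^ (- m)) <-> m <= val z.
  move=> z0; rewrite val_ge0 ?mulf_neq0 // valM // val_pi subr_ge0 //.
rewrite -ge // mulrDl; apply: OD; apply/ge => //; rewrite /m ge_min lexx ?orbT //.
Qed.

Lemma place_of_valuation_ring :
  exists r : place K, forall z, z != 0 -> O z <-> 0 <= ord r z.
Proof.
have v0 : val 0 = 0 by rewrite /val eqxx.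
have vs (n : int) : exists2 x, x != 0 & val x = n.
  by exists (pi ^ n); rewrite ?expfz_neq0.
by exists (Place v0 valM valD vs) => z; apply: val_ge0.
Qed.

End PlaceOfValuationRing.

(** * Maximal subalgebras avoiding 1/w are valuation rings *)

Section ValuationRingExistence.
Variables (F : finFieldType) (K : fieldExtType {fraction {poly F}}).
Implicit Types (R O : set K) (x y z : K).

Section MaximalSubalgebra.
Variables (w : K) (R : set K).
Hypotheses (w0 : w != 0) (aR : subalgebra R) (Rw : R w) (RVw : ~ R w^-1).
Hypothesis maxR : forall R', subalgebra R' -> (forall x, R x -> R' x) ->
  ~ R' w^-1 -> forall x, R' x -> R x.

Let RM x y : R x -> R y -> R (x * y). Proof. by case: aR => _ _; apply. Qed.
Let RD x y : R x -> R y -> R (x + y). Proof. by case: aR => _ + _; apply. Qed.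
Let RN x : R x -> R (- x). Proof. exact: subalgebraN. Qed.
Let R1 : R 1. Proof. exact: subalgebra1. Qed.
Let R0 : R 0. Proof. exact: subalgebra0. Qed.

(* w lies in the Jacobson radical of R, by maximality. *)
Let R_inv_1subM b : R b -> 1 - w * b != 0 /\ R (1 - w * b)^-1.
Proof.
move=> Rb; set s := 1 - w * b.
have Rs : R s by apply: RD => //; apply: RN; apply: RM.
have RsX k : R (s ^+ k) by apply: subalgebraX.
have s0 : s != 0.
  apply: contra_not_neq RVw => /eqP; rewrite subr_eq0 => /eqP wb.
  by have -> : w^-1 = b by rewrite -[b](mulKf w0) -wb mulr1.
split=> //.
(* The localization of R at the powers of s. It misses 1/w: every s^k has the form 1 - w b' with b'
   in R, so w^-1 s^k in R would put w^-1 = w^-1 s^k + b' in R. *)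
pose R' : set K := fun x => exists k, R (x * s ^+ k).
apply: (maxR (R' := R')) => [|x Rx||].
- split=> [c|x y [k hk] [l hl]|x y [k hk] [l hl]].
  + by exists 0%N; rewrite expr0 mulr1; case: aR.
  + exists (k + l)%N; rewrite exprD mulrDl; apply: RD.
      by rewrite mulrA; apply: RM.
    by rewrite mulrCA; apply: RM.
  + by exists (k + l)%N; rewrite exprD mulrACA; apply: RM.
- by exists 0%N; rewrite expr0 mulr1.
- case=> k Rk; apply: RVw.
  suff [b' Rb' sb'] : exists2 b', R b' & s ^+ k = 1 - w * b'.
    have -> : w^-1 = w^-1 * s ^+ k + b' by rewrite sb' mulrBr mulr1 mulKf // subrK.
    exact: RD.
  elim: k {Rk} => [|k [b' Rb' IH]]; first by exists 0; rewrite ?mulr0 ?subr0.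
  exists (b + b' - w * b * b').
    by apply: RD; [exact: RD|apply: RN; apply: RM => //; apply: RM].
  by rewrite exprS IH /s; ring.
- by exists 1%N; rewrite expr1 mulVf.
Qed.

Let polyR (p : {poly K}) := forall i, R p`_i.

(** The subalgebra R[y] strictly contains R, so by maximality it contains 1/w. *)
Let adjoin_inv y : ~ R y -> exists p, polyR p /\ p.[y] = w^-1.
Proof.
move=> nRy; apply: contrapT => no.
pose R' : set K := fun x => exists p, polyR p /\ p.[y] = x.
have RC c : R c -> polyR c%:P by move=> Rc i; rewrite coefC; case: eqP.
apply: nRy; apply: (maxR (R' := R')) => //.
- split=> [c|x z [p [hp <-]] [q [hq <-]]|x z [p [hp <-]] [q [hq <-]]].
  + exists (constf K c)%:P; rewrite hornerC; split=> //; apply: RC; by case: aR.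
  + by exists (p + q); rewrite hornerD; split=> // i; rewrite coefD; apply: RD.
  + exists (p * q); rewrite hornerM; split=> // i; rewrite coefM.
    apply: subspace_sum; first exact: subalgebra_subspace.
    by move=> j; apply: RM.
- by move=> x Rx; exists x%:P; rewrite hornerC; split=> //; apply: RC.
- exists 'X; rewrite hornerX; split=> // i; rewrite coefX; by case: eqP.
Qed.

(* If 1/w is a polynomial in y and a polynomial in 1/y, the equation of smaller
   degree, whose constant term can be moved to the left and inverted, rewrites
   the leading power in the other one by lower powers. *)
Let no_two_relations N : forall y (p q : {poly K}), (size p + size q <= N)%N ->
  y != 0 -> polyR p -> polyR q -> p.[y] = w^-1 -> q.[y^-1] = w^-1 -> False.
Proof.
elim: N => [|N IH] y p q sN y0 Rp Rq py qy.
  have : p = 0 by apply/eqP; rewrite -size_poly_eq0; lia.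
  by move=> p0; apply: RVw; rewrite -py p0 horner0.
wlog sqp : y p q sN y0 Rp Rq py qy / (size q <= size p)%N.
  move=> h; have [|/ltnW] := leqP (size q) (size p); first exact: (h y).
  by apply: (h y^-1); rewrite ?invr_eq0 ?invrK // addnC.
case sp : (size p) => [|n].
  by apply: RVw; rewrite -py (eqP (_ : p == 0)) ?horner0 // -size_poly_eq0 sp.
have sq : (size q <= n.+1)%N by rewrite -sp.
have sp' : (size p <= n.+1)%N by rewrite sp.
have [v0 Rv] := R_inv_1subM (Rq 0%N).
set v := (1 - w * q`_0)^-1 in Rv.
(* Multiplying q(1/y) = 1/w by w y^n gives (1 - w q_0) y^n = w (q_1 y^(n-1) + ... + q_n). Since 1 -
   w q_0 is a unit of R, y^n = s(y) with s of degree below n, and the leading term of p can be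
   replaced. *)
pose s := \poly_(i < n) (v * w * q`_(n - i)).
have Rs : polyR s.
  by move=> i; rewrite coef_poly; case: ifP => // _; apply: RM => //; apply: RM.
have sy : s.[y] = y ^+ n.
  have := qy; rewrite (horner_coef_wide _ sq) big_ord_recl /= expr0 mulr1.
  move=> hq; rewrite horner_poly.
  have -> : \sum_(i < n) v * w * q`_(n - i) * y ^+ i =
     v * w * y ^+ n * \sum_(i < n) q`_(bump 0 i) * y^-1 ^+ (bump 0 i).
    rewrite mulr_sumr [RHS](reindex_inj rev_ord_inj) /=; apply: eq_bigr => i _.
    have -> : bump 0 (n - i.+1) = (n - i)%N by have := ltn_ord i; rewrite /bump; lia.
    rewrite exprVn -!mulrA; congr (_ * (_ * _)); rewrite mulrCA; congr (_ * _).
    have -> : y ^+ n = y ^+ i * y ^+ (n - i) by rewrite -exprD subnKC // ltnW.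
    by rewrite mulfK // expf_neq0.
  have -> : \sum_(i < n) q`_(bump 0 i) * y^-1 ^+ (bump 0 i) = w^-1 - q`_0.
    by rewrite -hq addrC addKr.
  have -> : v * w * y ^+ n * (w^-1 - q`_0) = y ^+ n * (v * (w * w^-1 - w * q`_0)).
    by ring.
  by rewrite mulfV // mulVf // mulr1.
pose p' := \poly_(i < n) p`_i + p`_n *: s.
apply: (IH y p' q) => //.
- have : (size p' <= n)%N.
    rewrite (leq_trans (size_polyD _ _)) // geq_max size_poly /=.
    by rewrite (leq_trans (size_scale_leq _ _)) // size_poly.
  by move: sN; rewrite sp; lia.
- move=> i; rewrite coefD coefZ; apply: RD; last exact: RM.
  by rewrite coef_poly; case: ifP.
- rewrite hornerD hornerZ sy -py horner_poly [RHS](horner_coef_wide _ sp').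
  by rewrite big_ord_recr.
Qed.

Lemma maximal_subalgebra_valuation y : R y \/ R y^-1.
Proof.
have [->|y0] := eqVneq y 0; first by left.
apply: contrapT => /not_orP [/adjoin_inv [p [Rp py]] /adjoin_inv [q [Rq qy]]].
exact: (no_two_relations (leqnn _) y0 Rp Rq py qy).
Qed.

End MaximalSubalgebra.

Lemma exists_valuation_ring w : w != 0 -> (forall h, evalf w h != w^-1) ->
  exists O, [/\ subalgebra O, O w, ~ O w^-1 & forall y, O y \/ O y^-1].
Proof.
move=> w0 hw.
pose good O := [/\ subalgebra O, O w & ~ O w^-1].
pose P : set (set K) := fun O => O = set0 \/ good O.
have [] := @Zorn_bigcup K P.
  move=> C CP tot.
  have [[A CA gA]|no] := pselect (exists2 A, C A & good A); last first.
    left; apply/seteqP; split=> // x [A CA Ax].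
    have [A0|gA] := CP _ CA; first by rewrite A0 in Ax.
    by case: no; exists A.
  have gx B x : C B -> B x -> good B.
    by move=> CB Bx; have [B0|//] := CP _ CB; rewrite B0 in Bx.
  have [[hc _ _] Aw _] := gA.
  right; split; last first.
  - by case=> B CB Bw; have [_ _] := gx _ _ CB Bw; apply.
  - by exists A.
  have both (Q : K -> K -> K) : (forall B x y, good B -> B x -> B y -> B (Q x y)) ->
     forall x y, (\bigcup_(X in C) X)%classic x -> (\bigcup_(X in C) X)%classic y ->
       (\bigcup_(X in C) X)%classic (Q x y).
    move=> hQ x y [B CB Bx] [D CD Dy].
    have [BD|DB] := tot _ _ CB CD.
      by exists D => //; apply: hQ => //; [exact: gx Dy|exact: BD].
    by exists B => //; apply: hQ => //; [exact: gx Bx|exact: DB].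
  split=> [c||]; first by exists A.
  - by apply: both => B x y [[_ hD _] _ _]; apply: hD.
  - by apply: both => B x y [[_ _ hM] _ _]; apply: hM.
move=> O [PO maxO].
(* F[w] is good by [hw]; hence the maximal element is not the empty set. *)
pose Fw : set K := fun x => exists h, evalf w h = x.
have gFw : good Fw.
  split.
  - split=> [c|_ _ [g <-] [h <-]|_ _ [g <-] [h <-]].
    + by exists c%:P; rewrite evalfC.
    + by exists (g + h); rewrite evalfD.
    + by exists (g * h); rewrite evalfM.
  - by exists 'X; rewrite evalfX.
  - by case=> h /eqP; rewrite (negPf (hw h)).
have [aO Ow OVw] : good O.
  case: PO => // O0; case: (maxO Fw); last by right.
  by rewrite O0; split=> // h; case: (h w); case: gFw.
exists O; split=> //.
apply: (maximal_subalgebra_valuation w0 aO Ow OVw) => R' aR' OR' nR' x R'x.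
apply: contrapT => nOx; apply: (maxO R'); last first.
  by right; split=> //; apply: OR'.
by split=> // h; apply: nOx; apply: h.
Qed.

End ValuationRingExistence.

(** * Elementary properties of places; elements without poles *)

Section Places.
Variables (F : finFieldType) (K : fieldExtType {fraction {poly F}}).
Implicit Types (r s : place K) (x y z : K) (a b : int) (V W : set K).

Lemma place_inj r s : ord r =1 ord s -> r = s.
Proof.
case: r => f f0 fM fD fs; case: s => g g0 gM gD gs /funext /= fg.
by subst g; congr Place; apply: Prop_irrelevance.
Qed.

(* [ordM] and [ordD] infer other paths to the operations of K, on which lia
   does not identify the terms [ord r x]. *)
Lemma ord_mul r x y : x != 0 -> y != 0 -> ord r (x * y) = ord r x + ord r y.
Proof. exact: ordM. Qed.
Lemma ord_add r x y : x != 0 -> y != 0 -> x + y != 0 ->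
  Num.min (ord r x) (ord r y) <= ord r (x + y).
Proof. exact: ordD. Qed.

Lemma ord_one r : ord r 1 = 0.
Proof.
apply: (addrI (ord r 1)); rewrite addr0 -ord_mul ?oner_neq0 // mulr1 //.
Qed.

Lemma ordX r x n : x != 0 -> ord r (x ^+ n) = ord r x * n%:Z.
Proof.
move=> x0; elim: n => [|n IH]; first by rewrite expr0 ord_one mulr0.
by rewrite exprS ord_mul ?expf_neq0 // IH intS mulrDr mulr1.
Qed.

Lemma ordV r x : x != 0 -> ord r x^-1 = - ord r x.
Proof.
move=> x0; have := ord_mul r x0 (invr_neq0 x0); rewrite mulfV // ord_one; lia.
Qed.

Lemma ord_div r x y : x != 0 -> y != 0 -> ord r (x / y) = ord r x - ord r y.
Proof. by move=> x0 y0; rewrite ord_mul ?invr_eq0 // ordV. Qed.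

(** Since c^|F| = c, the order equals |F| times itself, with |F| > 1. *)
Lemma ord_constf r c : c != 0 -> ord r (constf K c) = 0.
Proof.
move=> c0; have k0 : constf K c != 0 by rewrite fmorph_eq0.
have := ordX r #|F| k0; rewrite -rmorphXn expf_card.
have := finNzRing_gt1 F; move: (ord r _) => o; move: #|F| => n; nia.
Qed.

Lemma ordN r x : ord r (- x) = ord r x.
Proof.
have [->|x0] := eqVneq x 0; first by rewrite oppr0.
have := ord_mul r (_ : -1 != 0) x0; rewrite mulN1r => ->; rewrite ?oppr_eq0 ?oner_eq0 //.
by rewrite -(rmorphN1 (constf K)) ord_constf ?add0r // oppr_eq0 oner_eq0.
Qed.

Lemma ordD_lt r x y : x != 0 -> y != 0 -> ord r x < ord r y ->
  x + y != 0 /\ ord r (x + y) = ord r x.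
Proof.
move=> x0 y0 xy.
have s0 : x + y != 0.
  apply: contraTneq xy => /eqP; rewrite addr_eq0 => /eqP ->.
  by rewrite ordN ltxx.
split=> //; have := ord_add r x0 y0 s0.
have := ord_add r s0 (_ : - y != 0); rewrite addrK ordN oppr_eq0 => /(_ y0 x0).
by lia.
Qed.

(** The guard puts 0 into every [vge r a], whatever the conventional value of [ord] at 0; these are
    the fractional ideals of the place. *)
Definition vge r a : set K := fun z => z != 0 -> a <= ord r z.

Lemma vge0 r a : vge r a 0. Proof. by rewrite /vge eqxx. Qed.

Lemma vge_ord r z : vge r (ord r z) z. Proof. by move=> _. Qed.

Lemma vge_le r a b z : a <= b -> vge r b z -> vge r a z.
Proof. by move=> ab h /h; apply: le_trans. Qed.

Lemma vgeD r a x y : vge r a x -> vge r a y -> vge r a (x + y).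
Proof.
have [->|x0] := eqVneq x 0; first by rewrite add0r.
have [->|y0] := eqVneq y 0; first by rewrite addr0.
move=> /(_ x0) hx /(_ y0) hy xy0.
by apply: le_trans (ord_add r x0 y0 xy0); rewrite le_min hx hy.
Qed.

Lemma vgeM r a b x y : vge r a x -> vge r b y -> vge r (a + b) (x * y).
Proof.
move=> hx hy; rewrite /vge mulf_eq0 negb_or => /andP [x0 y0].
by rewrite ord_mul // lerD ?hx ?hy.
Qed.

Lemma vge_constf r c : vge r 0 (constf K c).
Proof. by rewrite /vge fmorph_eq0 => c0; rewrite ord_constf. Qed.

Lemma vge_subspace r a : subspace (vge r a).
Proof.
split=> [|c x y hx hy]; first exact: vge0.
by apply: vgeD => //; rewrite -[a]add0r; apply: vgeM => //; apply: vge_constf.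
Qed.

Lemma vgeMr r a x y : x != 0 -> vge r (a + ord r x) (x * y) <-> vge r a y.
Proof.
move=> x0; split=> h; last by rewrite addrC; apply: vgeM => //; apply: vge_ord.
by move=> y0; have := h (mulf_neq0 x0 y0); rewrite ord_mul //; lia.
Qed.

Lemma valuation_idealE r : valuation_ideal r = vge r 1.
Proof.
by apply/funext => x; apply/propext; split=> h z0; have := h z0; rewrite gtz0_ge1.
Qed.

Lemma exists_zero (x : K) : x != 0 -> (forall h, evalf x h != x^-1) ->
  exists r, 0 < ord r x.
Proof.
move=> x0 hx; have [O [aO Ox OVx valO]] := exists_valuation_ring x0 hx.
have [r hr] := place_of_valuation_ring aO valO Ox OVx.
exists r; rewrite ltNge; apply/negP => h; apply: OVx.
by apply/hr; rewrite ?invr_eq0 // ordV // oppr_ge0.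
Qed.

(** If x = h(1/x) for a polynomial h, then 1/x is a root of X h - 1, hence constant. Otherwise
    [exists_zero] yields a zero of 1/x, that is, a pole of x. *)
Lemma no_pole_constant x : full_constant_field F K ->
  (forall r, vge r 0 x) -> exists c, x = constf K c.
Proof.
move=> fc hx; have [->|x0] := eqVneq x 0; first by exists 0; rewrite rmorph0.
suff [c hc] : exists c, x^-1 = constf K c.
  by exists c^-1; rewrite -[x]invrK hc fmorphV.
apply: contrapT => no.
have [||r] := @exists_zero x^-1; first by rewrite invr_eq0.
  2: by rewrite ordV // oppr_gt0 ltNge hx.
move=> h; rewrite invrK; apply/eqP => hE; apply: no; apply: fc.
exists ('X * h + (-1)%:P).
  apply/eqP => /(congr1 (coefp 0)); rewrite /= coefD coefXM coefC /= add0r coef0.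
  by move/eqP; rewrite oppr_eq0 oner_eq0.
apply/eqP; rewrite -[LHS]/(evalf _ _) evalfD evalfM evalfX evalfC hE.
by rewrite mulVf // rmorphN1 subrr.
Qed.

Lemma vge_subalgebra r : subalgebra (vge r 0).
Proof.
split=> [c|x y|x y hx hy]; [exact: vge_constf|exact: vgeD|].
by rewrite -[0](addr0 0); apply: vgeM.
Qed.

Lemma exists_basis_mod V W N : subspace W ->
    (forall n (z : 'I_n -> K), indep_mod V W z -> (n <= N)%N) ->
  exists n (z : 'I_n -> K), basis_mod V W z.
Proof.
move=> sW hN; apply: contrapT => no.
have ex n : exists z : 'I_n -> K, indep_mod V W z.
  elim: n => [|n [z iz]]; first by exists (fun=> 0); split=> [[]//|c _]; rewrite thinmx0.
  have [x Vx nx] : exists2 x, V x & forall c, ~ W (x - lincomb z c).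
    apply: contrapT => h; apply: no; exists n, z; split=> //; split; first by case: iz.
    move=> x Vx; apply: contrapT => h'; apply: h; exists x => // c Wc.
    by apply: h'; exists c.
  rewrite -addn1; exists (join z (fun _ : 'I_1 => x)); split=> [i|c].
    by rewrite /join; case: split => // j; case: iz.
  rewrite -(hsubmxK c) lincomb_join; set c1 := lsubmx c; set c2 := rsubmx c.
  rewrite [X in _ + X]/lincomb big_ord1 => h.
  have c20 : c2 0 ord0 = 0.
    apply: contrapT => /eqP c20; apply: (nx (- ((c2 0 ord0)^-1 *: c1))).
    suff -> : x - lincomb z (- ((c2 0 ord0)^-1 *: c1)) =
       constf K (c2 0 ord0)^-1 * (lincomb z c1 + constf K (c2 0 ord0) * x).
      exact: subspaceZ.
    rewrite mulrDr mulrA -rmorphM mulVf // rmorph1 mul1r addrC; congr (_ + _).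
    rewrite /lincomb mulr_sumr -sumrN; apply: eq_bigr => i _.
    by rewrite !mxE rmorphN rmorphM mulNr opprK mulrA.
  have c20' : c2 = 0 by apply/rowP => i; rewrite ord1 c20 mxE.
  move: h; rewrite c20 rmorph0 mul0r addr0 => h.
  have c10 : c1 = 0 by case: iz => _; apply.
  by rewrite c10 c20' row_mx0.
by have [z /hN] := ex N.+1; rewrite ltnn.
Qed.

Lemma exists_ord r (n : int) : exists2 x, x != 0 & ord r x = n.
Proof. exact: ord_surj. Qed.

(** The valuation ring modulo a uniformizer falls under [indep_mod_bound]. So [place_deg] is a true
    dimension and not the default value of [dim_mod]. *)
Lemma place_deg_basis r :
  exists b : 'I_(place_deg r) -> K, basis_mod (vge r 0) (vge r 1) b.
Proof.
have [x x0 ox] := exists_ord r 1.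
have mE : multiples x (vge r 0) = vge r 1.
  apply/funext => z; apply/propext; rewrite /multiples -(@vgeMr r 0 x) // ox add0r.
  by rewrite mulrC divfK.
have [|N hN] := @indep_mod_bound F K _ x (vge_subalgebra r) _ x0.
  by rewrite /vge ox.
rewrite mE in hN.
have [n [b hb]] := exists_basis_mod (vge_subspace r 1) hN.
have [] := xgetPex 0%N (_ : exists n, exists b : n.-tuple K,
    is_basis_mod (valuation_ring r) (valuation_ideal r) b).
  exists n, [tuple b i | i < n]; rewrite valuation_idealE.
  apply/is_basis_modP; first exact: vge_subspace.
  suff -> : tnth [tuple b i | i < n] = b by [].
  by apply/funext => i; rewrite tnth_mktuple.
move=> t /is_basis_modP ht; exists (tnth t); rewrite -valuation_idealE.
by apply: ht; rewrite valuation_idealE; apply: vge_subspace.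
Qed.

Lemma place_deg_gt0 r : (0 < place_deg r)%N.
Proof.
have [b [_ [_ sb]]] := place_deg_basis r.
rewrite lt0n; apply: contraT => /negPn /eqP d0.
have [|c] := sb 1; first by rewrite /vge ord_one.
rewrite /lincomb big1 ?subr0 => [/(_ (oner_neq0 K))|i]; first by rewrite ord_one.
by suff : (i < 0)%N by []; rewrite -[X in (_ < X)%N]d0 ltn_ord.
Qed.

End Places.

(** * Weak approximation and the number of zeros *)

Section WeakApproximation.
Variables (F : finFieldType) (K : fieldExtType {fraction {poly F}}).
Implicit Types (r s t : place K) (x y z w : K) (S T : seq (place K)).

Lemma seq_int_bound (I : eqType) (T : seq I) (f : I -> int) :
  exists N : nat, forall i, i \in T -> `|f i| < N%:Z.
Proof.
elim: T => [|j T [N hN]]; first by exists 0%N.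
exists (N + `|f j|.+1)%N => i; rewrite inE => /orP [/eqP ->|/hN]; lia.
Qed.

Lemma ordXz r x (n : int) : x != 0 -> ord r (x ^ n) = ord r x * n.
Proof.
move=> x0; case: n => n; first exact: ordX.
by rewrite NegzE -exprnN ordV ?expf_neq0 // ordX // mulrN.
Qed.

(** Otherwise positive order at s forces positive order at r, so order 0 at r forces order 0 at s.
    Then [ord s] is a multiple of [ord r], and since both are normalized the factor is 1. *)
Let exists_pos_nonpos r s : r != s ->
  exists x, [/\ x != 0, 0 < ord s x & ord r x <= 0].
Proof.
move=> /eqP rs; apply: contrapT => no; apply: rs.
have pos x : x != 0 -> 0 < ord s x -> 0 < ord r x.
  by move=> x0 h; rewrite ltNge; apply/negP => h'; apply: no; exists x.
have nneg x : x != 0 -> 0 <= ord r x -> 0 <= ord s x.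
  move=> x0 h; rewrite leNgt; apply/negP => h'.
  by have := pos x^-1; rewrite invr_eq0 !ordV // => /(_ x0); lia.
have zero x : x != 0 -> ord r x = 0 -> ord s x = 0.
  move=> x0 h; have := nneg x x0; have := nneg x^-1.
  by rewrite invr_eq0 !ordV // => /(_ x0); lia.
have [p p0 op] := exists_ord r 1.
have prop x : x != 0 -> ord s x = ord s p * ord r x.
  move=> x0; have px0 : p ^ ord r x != 0 by rewrite expfz_neq0.
  have := zero (x / p ^ ord r x); rewrite mulf_neq0 ?invr_eq0 //.
  rewrite !ord_div // !ordXz // op mul1r subrr => /(_ isT erefl).
  by move/eqP; rewrite subr_eq0 => /eqP.
have [y y0 oy] := exists_ord s 1.
have p1 : ord s p = 1.
  have := prop y y0; rewrite oy; have := nneg p p0; rewrite op => /(_ isT).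
  by move: (ord s p) (ord r y) => m n m0; have [n0|n0] := lerP n 0; nia.
apply: place_inj => x; have [->|x0] := eqVneq x 0; first by rewrite !Defs.ord0.
by rewrite [RHS]prop // p1 mul1r.
Qed.

Lemma exists_separating r s : r != s ->
  exists x, [/\ x != 0, ord r x < 0 & 0 < ord s x].
Proof.
move=> rs; have [x [x0 sx rx]] := exists_pos_nonpos rs.
have sr : s != r by rewrite eq_sym.
have [y [y0 ry sy]] := exists_pos_nonpos sr.
by exists (x / y); rewrite !ord_div // mulf_neq0 ?invr_eq0 //; split=> //; lia.
Qed.

(** Induction of Artin and Whaples. For a new place s, let d have a pole at r and a zero at s;
    according as c has positive, zero or negative order at s, take c, c^n d or d c^n / (c^n + 1)
    with n large. *)
Lemma exists_pole_zeros r T : r \notin T ->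
  exists c, [/\ c != 0, ord r c < 0 & forall t, t \in T -> 0 < ord t c].
Proof.
elim: T => [_|s T IH].
  by have [c c0 oc] := exists_ord r (-1); exists c; split=> //; rewrite oc.
rewrite inE negb_or => /andP [rs /IH [c [c0 rc Tc]]].
have [d [d0 rd sd]] := exists_separating rs.
have [N hN] := seq_int_bound T (fun t => ord t d).
pose cN := c ^+ N.+1.
have cN0 : cN != 0 by rewrite expf_neq0.
have ocN t : ord t cN = ord t c * N.+1%:Z by rewrite ordX.
have TcN t : t \in T -> 0 < ord t cN + ord t d.
  by move=> tT; have := Tc t tT; have := hN t tT; rewrite ocN; nia.
have [sc|sc|sc] := ltgtP (ord s c) 0; last first.
- exists (cN * d); split; first by rewrite mulf_neq0.
    by rewrite ord_mul // ocN; nia.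
  move=> t; rewrite ord_mul // inE => /orP [/eqP ->|/TcN //].
  by rewrite ocN sc mul0r add0r.
- by exists c; split=> // t; rewrite inE => /orP [/eqP ->|/Tc].
- have neg t : ord t c < 0 -> cN + 1 != 0 /\ ord t (cN + 1) = ord t cN.
    by move=> h; apply: ordD_lt; rewrite ?oner_neq0 // ord_one ocN; nia.
  have [e0 re] := neg r rc; have [_ se] := neg s sc.
  exists (d * cN / (cN + 1)); split.
  + by rewrite !mulf_neq0 ?invr_eq0.
  + by rewrite ord_div ?ord_mul ?mulf_neq0 // re addrK.
  + move=> t; rewrite inE ord_div ?ord_mul ?mulf_neq0 // => /orP [/eqP ->|tT].
      by rewrite se addrK.
    have tc := Tc t tT.
    rewrite [cN + 1]addrC.
    have [_ ->] : 1 + cN != 0 /\ ord t (1 + cN) = ord t 1.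
      by apply: ordD_lt; rewrite ?oner_neq0 // ord_one ocN; nia.
    by rewrite ord_one subr0 addrC TcN.
Qed.

(** If c has a pole at r and zeros on T, then c / (c + 1) has order 0 at r and positive order on T;
    a high power of it meets the bounds A. *)
Lemma exists_unit_approx r T (A : place K -> int) : r \notin T ->
  exists w, [/\ w != 0, ord r w = 0 & forall t, t \in T -> A t <= ord t w].
Proof.
move=> /exists_pole_zeros [c [c0 rc Tc]].
have [N hN] := seq_int_bound T A.
have [e0 re] : c + 1 != 0 /\ ord r (c + 1) = ord r c.
  by apply: ordD_lt; rewrite ?oner_neq0 // ord_one.
have u0 : c / (c + 1) != 0 by rewrite mulf_neq0 ?invr_eq0.
exists ((c / (c + 1)) ^+ N); split; first by rewrite expf_neq0.
  by rewrite ordX // ord_div // re subrr mul0r.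
move=> t tT; rewrite ordX // ord_div //.
have tc := Tc t tT.
have [_] : 1 + c != 0 /\ ord t (1 + c) = ord t 1.
  by apply: ordD_lt; rewrite ?oner_neq0 // ord_one.
rewrite addrC ord_one => ->; have := hN t tT; nia.
Qed.

(** Unlike a Riemann-Roch space it imposes nothing outside S, so weak approximation gives the exact
    dimension of quotients. *)
Definition VS S (A : place K -> int) : set K :=
  fun z => forall r, r \in S -> vge r (A r) z.

Lemma VS_subspace S A : subspace (VS S A).
Proof.
split=> [r _|a x y hx hy r rS]; first exact: vge0.
by have [_] := vge_subspace r (A r); apply; [exact: hx|exact: hy].
Qed.

Lemma VS_le S A B z : (forall r, r \in S -> A r <= B r) -> VS S B z -> VS S A z.
Proof. by move=> AB h r rS; apply: vge_le (AB r rS) (h r rS). Qed.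

(** Raising the bound at r by 1 cuts out a copy of the residue field. Its basis is transported by p
    w, where p has order A r at r and w is a unit at r whose high order at the rest of S restores
    the other bounds. *)
Let VS_basis1 S (A : place K -> int) r : uniq S -> r \in S ->
  exists b : 'I_(place_deg r) -> K,
    basis_mod (VS S A) (VS S (fun s => A s + (r == s)%:Z)) b.
Proof.
move=> uS rS; have [b [[Vb ib] [_ sb]]] := place_deg_basis r.
have [p p0 op] := exists_ord r (A r).
pose T := [seq s <- S | s != r].
have rT : r \notin T by rewrite mem_filter eqxx.
pose D s := A s + \sum_l `|ord s (p * b l)|.
have [w [w0 rw Tw]] := exists_unit_approx D rT.
have u0 : p * w != 0 by rewrite mulf_neq0.
have ou : ord r (p * w) = A r by rewrite ord_mul // rw addr0.
pose B l := p * w * b l.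
have BE c : lincomb B c = p * w * lincomb b c.
  by rewrite /lincomb mulr_sumr; apply: eq_bigr => l _; rewrite mulrCA.
have VB l : VS S A (B l).
  move=> s sS; have [->|sr] := eqVneq s r.
    by rewrite -ou -[ord _ _]add0r; apply/vgeMr.
  move=> Bl0; have bl0 : b l != 0 by apply: contraNneq Bl0 => bl; rewrite /B bl mulr0.
  have sT : s \in T by rewrite mem_filter sr.
  have := Tw s sT; rewrite /D (bigD1 l) //=.
  have : 0 <= \sum_(i < place_deg r | i != l) `|ord s (p * b i)| by apply: sumr_ge0.
  have -> : ord s (B l) = ord s w + ord s (p * b l).
    by rewrite /B -ord_mul ?mulf_neq0 //; congr (ord s _); ring.
  have := ler_norm (- ord s (p * b l)); rewrite normrN.
  move: (ord s w) (ord s (p * b l)) `|ord s (p * b l)| (\sum_(i | _) _) => i j k m.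
  by move: (A s) => a; clear; lia.
exists B; split; split=> //; last move=> z hz.
  move=> c /(_ r rS).
  by rewrite eqxx BE -{1}ou addrC => /vgeMr-/(_ u0)/ib.
have : vge r 0 (z / (p * w)).
  apply/(@vgeMr _ _ r 0 (p * w)) => //; rewrite ou add0r mulrC divfK //.
  exact: hz.
case/sb => c hc; exists c => s sS.
have E : z - lincomb B c = p * w * (z / (p * w) - lincomb b c).
  by rewrite BE mulrBr mulrCA mulfV // mulr1.
have [<-|rs] := eqVneq r s; first by rewrite E -ou addrC; apply/vgeMr.
rewrite addr0; apply: (subspaceB (vge_subspace _ _)); first exact: hz.
by apply: lincomb_sub => [|l]; [exact: vge_subspace|exact: VB].
Qed.

Let VS_basis_seq S T : uniq S -> {subset T <= S} -> forall A : place K -> int,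
  exists b : 'I_(\sum_(t <- T) place_deg t)%N -> K,
    basis_mod (VS S A) (VS S (fun s => A s + (count_mem s T)%:Z)) b.
Proof.
move=> uS; elim: T => [|t T IH] TS A.
  rewrite big_nil; exists (fun=> 0); split; split; try by case.
    by move=> c _; rewrite thinmx0.
  move=> x hx.
  by exists 0; rewrite lincomb0 subr0 => r rS; rewrite addr0; apply: hx.
have tS : t \in S by apply: TS; rewrite mem_head.
have [b [ib sb]] := VS_basis1 A uS tS.
have [|b' [ib' sb']] := IH _ (fun s => A s + (t == s)%:Z).
  by move=> s sT; apply: TS; rewrite inE sT orbT.
rewrite big_cons; exists (join b b').
have -> : VS S (fun s => A s + (count_mem s (t :: T))%:Z) =
          VS S (fun s => A s + (t == s)%:Z + (count_mem s T)%:Z).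
  by congr VS; apply/funext => s /=; rewrite PoszD addrA.
have le1 z : VS S (fun s => A s + (t == s)%:Z) z -> VS S A z.
  by apply: VS_le => r _; rewrite lerDl.
have le2 z : VS S (fun s => A s + (t == s)%:Z + (count_mem s T)%:Z) z ->
    VS S (fun s => A s + (t == s)%:Z) z.
  by apply: VS_le => r _; rewrite lerDl.
split; first exact: (indep_mod_trans (VS_subspace _ _) le1 le2 ib ib').
exact: (span_mod_trans le1 sb sb').
Qed.

Lemma VS_basis S (A B : place K -> int) : uniq S ->
    (forall r, r \in S -> A r <= B r) ->
  exists b : 'I_(\sum_(r <- S) `|B r - A r| * place_deg r)%N -> K,
    basis_mod (VS S A) (VS S B) b.
Proof.
(* T lists the unit steps from A to B, each place with its multiplicity. *)
move=> uS AB; pose T := flatten [seq nseq `|B r - A r| r | r <- S].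
have TS : {subset T <= S}.
  by move=> r /flatten_mapP [s sS]; rewrite mem_nseq => /andP [_ /eqP ->].
have := VS_basis_seq uS TS A.
have -> : (\sum_(t <- T) place_deg t = \sum_(r <- S) `|B r - A r| * place_deg r)%N.
  rewrite big_flatten big_map; apply: eq_bigr => r _.
  by rewrite big_nseq iter_addn_0 mulnC.
suff -> : VS S (fun s => A s + (count_mem s T)%:Z) = VS S B by [].
have cT r : r \in S -> A r + (count_mem r T)%:Z = B r.
  move=> rS; suff -> : count_mem r T = `|B r - A r|%N by have := AB r rS; lia.
  rewrite count_flatten sumnE !big_map (bigD1_seq r) //= count_nseq /= eqxx mul1n.
  rewrite big1 ?addn0 // => s sr.
  by rewrite count_nseq /= (negPf sr).
by apply/seteqP; split=> z h r rS; have := h r rS; rewrite cT.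
Qed.

(** For the ring O of elements integral on S, the quotient O / x O has the degree of the zeros of x
    on S as its dimension, and a basis of it is F[x]-independent. *)
Lemma zeros_poly_indep x S : x != 0 -> uniq S -> (forall r, r \in S -> 0 < ord r x) ->
  exists b : 'I_(\sum_(r <- S) `|ord r x| * place_deg r)%N -> K, poly_indep x b.
Proof.
move=> x0 uS Sx.
have := @VS_basis S (fun=> 0) (fun r => ord r x) uS (fun r rS => ltW (Sx r rS)).
under eq_bigr do rewrite subr0.
case=> b [ib _]; exists b; move: ib.
have aO : subalgebra (VS S (fun=> 0)).
  split=> [c r _|y z hy hz r rS|y z hy hz r rS]; first exact: vge_constf.
    by apply: vgeD; [exact: hy|exact: hz].
  by rewrite -[0](addr0 0); apply: vgeM; [exact: hy|exact: hz].
have <- : multiples x (VS S (fun=> 0)) = VS S (fun r => ord r x).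
  have e z r : vge r 0 (z / x) <-> vge r (ord r x) z.
    by rewrite -(@vgeMr _ _ r 0 x) // add0r mulrC divfK.
  by apply/seteqP; split=> z h r rS; apply/e; apply: h.
apply: indep_mod_poly_indep => // r rS _; exact: ltW (Sx r rS).
Qed.

Lemma zeros_bound x : x != 0 -> exists N, forall S, uniq S ->
  (forall r, r \in S -> 0 < ord r x) -> (size S <= N)%N.
Proof.
move=> x0; have [N hN] := poly_indep_bound x; exists N => S uS Sx.
have [b /hN] := zeros_poly_indep x0 uS Sx.
apply: leq_trans; rewrite -sum1_size [X in (X <= _)%N]big_seq [X in (_ <= X)%N]big_seq.
apply: leq_sum => r rS; have := Sx r rS; have := place_deg_gt0 r.
by move: (ord r x) (place_deg r) => m n; nia.
Qed.

Lemma exists_seq_of_bound (P : place K -> Prop) N :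
    (forall S, uniq S -> (forall r, r \in S -> P r) -> (size S <= N)%N) ->
  exists S, uniq S /\ forall r, r \in S <-> P r.
Proof.
move=> hN; apply: contrapT => no.
have ex n : exists S, [/\ uniq S, forall r, r \in S -> P r & size S = n].
  elim: n => [|n [S [uS SP sS]]]; first by exists [::].
  have [r Pr rS] : exists2 r, P r & r \notin S.
    apply: contrapT => h; apply: no; exists S; split=> // r; split; first exact: SP.
    by move=> Pr; apply: contrapT => /negP rS; apply: h; exists r.
  exists (r :: S); split; rewrite /= ?rS ?sS // => s.
  by rewrite inE => /orP [/eqP ->|/SP].
have [S [uS SP sS]] := ex N.+1.
by have := hN S uS SP; rewrite sS ltnn.
Qed.

Lemma exists_zeros x : x != 0 -> exists S, uniq S /\ forall r, r \in S <-> 0 < ord r x.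
Proof. by move=> /zeros_bound [N hN]; apply: exists_seq_of_bound hN. Qed.

End WeakApproximation.

(** * Riemann's inequality *)

Section RiemannInequality.
Variables (F : finFieldType) (K : fieldExtType {fraction {poly F}}).
Implicit Types (r s : place K) (x y z w : K) (S T : seq (place K)) (D : place K -> int).
Implicit Types (g h : {poly F}).

(** The quotient is a polynomial in 1/x. *)
Lemma evalf_div_vge r x h n : x != 0 -> ord r x <= 0 -> (size h <= n.+1)%N ->
  vge r 0 (evalf x h / x ^+ n).
Proof.
move=> x0 rx hn; rewrite (@evalf_coef _ _ _ n.+1) // mulr_suml.
apply: subspace_sum => [|i]; first exact: vge_subspace.
rewrite -mulrA -[0](addr0 0); apply: vgeM; first exact: vge_constf.
move=> _; rewrite ord_div ?expf_neq0 // !ordX //.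
by have := ltn_ord i; move: (ord r x) rx (nat_of_ord i) => m; clear; nia.
Qed.

(* If sum_(k <= m) h_k(x) z^k = 0, then h_m(x) z / x^n is integral at the places
   where x has no zero: divide by z^(m-1) where z has a pole. *)
Lemma exists_integral_multiple x z : x != 0 -> exists g n, g != 0 /\
  forall n', (n <= n')%N -> forall r, ord r x <= 0 ->
    vge r 0 (evalf x g / x ^+ n' * z).
Proof.
move=> x0; have [N hN] := poly_indep_bound x.
have [h [sh [i hi]]] : exists h : 'I_N.+1 -> {poly F},
    \sum_i evalf x (h i) * z ^+ i = 0 /\ exists i, h i != 0.
  apply: contrapT => no.
  suff /hN : poly_indep x (fun i : 'I_N.+1 => z ^+ i) by rewrite ltnn.
  move=> h sh i.
  by apply: contrapT => /eqP hi; apply: no; exists h; split=> //; exists i.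
have [m hm mmax] := arg_maxnP (P := fun i => h i != 0) (fun i => i : nat) hi.
exists (h m), (\max_i size (h i))%N; split=> // n hn r rx.
have hG (k : 'I_N.+1) : vge r 0 (evalf x (h k) / x ^+ n).
  apply: evalf_div_vge => //; apply: leqW; apply: leq_trans hn.
  exact: (leq_bigmax k).
have [z0|z0] := eqVneq z 0; first by rewrite z0 mulr0; apply: vge0.
have [rz|rz] := lerP 0 (ord r z).
  by rewrite -[0](addr0 0); apply: vgeM => // _.
have E : evalf x (h m) * z ^+ m = - \sum_(k | k != m) evalf x (h k) * z ^+ k.
  by apply/eqP; rewrite -addr_eq0 -(bigD1 m (P := predT)) //= sh.
case mE : (nat_of_ord m) => [|m'].
  have := E; rewrite mE expr0 mulr1 big1 ?oppr0 => [-> |k km].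
    by rewrite !mul0r; apply: vge0.
  rewrite (_ : h k = 0) ?evalf0 ?mul0r //; apply/eqP; apply: contraT => hk.
  have : (k <= m)%N := mmax _ hk.
  by rewrite mE leqn0 => /eqP k0; case/eqP: km; apply: val_inj; rewrite /= k0 mE.
have -> : evalf x (h m) / x ^+ n * z =
    - \sum_(k | k != m) (evalf x (h k) / x ^+ n) * (z ^+ k / z ^+ m').
  have zm : z ^+ m' != 0 by rewrite expf_neq0.
  apply: (mulIf zm); rewrite mulNr mulr_suml.
  have -> : evalf x (h m) / x ^+ n * z * z ^+ m' = evalf x (h m) * z ^+ m / x ^+ n.
    by rewrite mE exprS; ring.
  rewrite E mulNr mulr_suml; congr (- _); apply: eq_bigr => k _.
  by rewrite mulrA divfK // mulrAC.
apply: (subspaceN (vge_subspace r 0)).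
apply: (big_ind (vge r 0)) => [|a b|k km]; [exact: vge0|exact: vgeD|].
rewrite -[0](addr0 0); have [hk|hk] := eqVneq (h k) 0.
  by rewrite hk evalf0 !mul0r; apply: vge0.
apply: vgeM => // _; rewrite ord_div ?expf_neq0 // !ordX //.
have : (k < m)%N by rewrite ltn_neqAle km; apply: mmax.
by rewrite mE; move: (ord r z) rz (nat_of_ord k) => o; clear; nia.
Qed.

(** Scaling each b_i by g_i(x) / x^n0 with one exponent n0 for all i keeps the family
    F[x]-independent. *)
Lemma exists_integral_family x n (b : 'I_n -> K) : x != 0 -> poly_indep x b ->
  exists u : 'I_n -> K, poly_indep x u /\
    forall i r, ord r x <= 0 -> vge r 0 (u i).
Proof.
move=> x0 ib.
have [g hg] := choice (fun i => exists_integral_multiple (b i) x0).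
have [m hm] := choice hg.
pose n0 := (\max_i m i)%N.
exists (fun i => evalf x (g i) / x ^+ n0 * b i); split; last first.
  by move=> i r; case: (hm i) => _; apply; apply: (leq_bigmax i).
move=> h sh i; have g0 : g i != 0 by case: (hm i).
suff : h i * g i = 0.
  by move/eqP; rewrite mulf_eq0 (negPf g0) orbF => /eqP.
move: i {g0}; apply: ib.
have xn : x ^+ n0 != 0 by rewrite expf_neq0.
rewrite -[RHS](mulr0 (x ^+ n0)) -[X in _ = _ * X]sh mulr_sumr; apply: eq_bigr => i _.
rewrite evalfM; move: (x ^+ n0) xn (evalf x (h i)) (evalf x (g i)) => y y0 e e'.
by rewrite [e' / y * _]mulrAC [RHS]mulrCA [y * _]mulrC divfK // mulrA.
Qed.

(** Divisors are handled as functions here; this is the degree when S contains the support of D. *)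
Definition degree S D : int := \sum_(r <- S) D r * (place_deg r)%:Z.

Lemma degree_subset S T D : uniq S -> uniq T -> {subset S <= T} ->
  (forall r, r \notin S -> D r = 0) -> degree T D = degree S D.
Proof.
move=> uS uT ST D0; rewrite /degree (bigID (mem S)) /= [X in _ + X]big1 ?addr0.
  rewrite -big_filter; apply: perm_big; apply: uniq_perm => //.
    exact: filter_uniq.
  by move=> r; rewrite mem_filter; case rS: (r \in S) => //=; apply: ST.
by move=> r rS; rewrite D0 // mul0r.
Qed.

Let exists_common_zero S : uniq S -> S != [::] ->
  exists2 x, x != 0 & forall r, r \in S -> 0 < ord r x.
Proof.
case: S => // r T /= /andP [rT uT] _.
have [p p0 op] := exists_ord r 1.
have [w [w0 rw Tw]] := exists_unit_approx (fun t => 1 - ord t p) rT.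
exists (p * w) => [|t]; first by rewrite mulf_neq0.
rewrite inE ord_mul // => /orP [/eqP ->|/Tw]; first by rewrite op rw.
by move: (ord t p) (ord t w) => i j; clear; lia.
Qed.

Let sum_Posz (I : Type) (T : seq I) (f : I -> nat) :
  (\sum_(i <- T) f i)%N%:Z = \sum_(i <- T) (f i)%:Z.
Proof. exact: (big_morph Posz PoszD (erefl _)). Qed.

(** Let x vanish on S, with set of zeros T of total degree N. The N (j + 1) elements u_i x^(k - j),
    k <= j, have poles only in T, and forcing the bound - D on T costs N j + C - deg D conditions,
    fewer than N (j + 1) once deg D >= C. The constant C absorbs the poles of the u_i. *)
Lemma riemann_inequality S : uniq S -> S != [::] -> exists C : int,
  forall D, (forall r, r \notin S -> D r = 0) -> C <= degree S D ->
    exists2 z, z != 0 & forall r, - D r <= ord r z.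
Proof.
move=> uS S0; have [x x0 Sx] := exists_common_zero uS S0.
have [T [uT TP]] := exists_zeros x0.
have Tx r : r \in T -> 0 < ord r x by move/TP.
have ST : {subset S <= T} by move=> r /Sx /TP.
have [] := zeros_poly_indep x0 uT Tx.
set N := (\sum_(r <- T) _)%N => b ib.
have N0 : (0 < N)%N.
  case: S S0 {uS Sx} ST => // r S _ /(_ r); rewrite mem_head => /(_ isT) rT.
  rewrite /N (bigD1_seq r) //=; have := Tx r rT; have := place_deg_gt0 r.
  by move: (ord r x) (place_deg r) => m n; nia.
have [u [iu u_int]] := exists_integral_family x0 ib.
pose c r := (\sum_i `|ord r (u i)|)%N.
exists (degree T (fun r => (c r)%:Z)) => D D0.
rewrite -(degree_subset uS uT ST D0) => degD.
(* Since [j] bounds D on T and x has order at least 1 there, A <= - D holds, as [VS_basis]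
   requires. *)
pose j := (\sum_(r <- T) `|D r|)%N.
pose A r := - (j%:Z * ord r x + (c r)%:Z).
have AD r : r \in T -> A r <= - D r.
  move=> rT; rewrite lerN2; apply: le_trans (_ : j%:Z <= _).
    rewrite /j (bigD1_seq r) //= PoszD -[D r]addr0; apply: lerD => //.
    by move: (D r) => m; clear; lia.
  by have := Tx r rT; move: (ord r x) (c r) => o k; clear; nia.
have [B [_ sB]] := VS_basis uT AD.
pose v (ik : 'I_N * 'I_j.+1) := u ik.1 * (x ^+ ik.2 / x ^+ j).
have xk0 k : x ^+ k != 0 by rewrite expf_neq0.
have vV ik : VS T A (v ik).
  move=> r rT; rewrite /v /=; have [-> |ui0] := eqVneq (u ik.1) 0.
    by rewrite mul0r; apply: vge0.
  have k0 : (x ^+ ik.2 / x ^+ j) != 0 by rewrite mulf_neq0 ?invr_eq0.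
  move=> _; rewrite ord_mul // ord_div ?xk0 // !ordX // /A.
  have : (`|ord r (u ik.1)| <= c r)%N by rewrite /c (bigD1 ik.1) //= leq_addr.
  have := Tx r rT; move: (ord r x) (ord r _) (c r) (nat_of_ord ik.2) => o o' k l.
  by clear; nia.
have card : (\sum_(r <- T) `|(- D r) - A r| * place_deg r < #|{: 'I_N * 'I_j.+1}|)%N.
  rewrite card_prod !card_ord.
  suff E : (\sum_(r <- T) `|(- D r) - A r| * place_deg r)%N%:Z =
      j%:Z * N%:Z + degree T (fun r => (c r)%:Z) - degree T D.
    suff : (\sum_(r <- T) `|(- D r) - A r| * place_deg r <= j * N)%N by lia.
    by rewrite -lez_nat E PoszM; lia.
  rewrite sum_Posz [N%:Z]sum_Posz mulr_sumr /degree -big_split -sumrB /=.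
  rewrite [LHS]big_seq [RHS]big_seq; apply: eq_bigr => r rT.
  rewrite !PoszM (gez0_abs (ltW (Tx r rT))) gez0_abs ?subr_ge0 ?AD // /A.
  move: (D r) (ord r x) (Posz (c r)) (Posz j) (Posz (place_deg r)) => d o k m f.
  by ring.
have [f [[[i k] fik] hf]] := span_mod_dependent (VS_subspace T (fun r => - D r)) sB vV card.
pose h (i : 'I_N) : {poly F} := \poly_(k < j.+1) f (i, inord k).
set z := \sum_i _ in hf.
(* Clearing x^j makes z an F[x]-combination of the u_i, so z = 0 would force all h_i = 0. *)
have zE : \sum_i evalf x (h i) * u i = x ^+ j * z.
  rewrite /z mulr_sumr.
  have -> : \sum_ik x ^+ j * (constf K (f ik) * v ik) =
    \sum_i \sum_(k < j.+1) x ^+ j * (constf K (f (i, k)) * v (i, k)).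
    by rewrite pair_bigA; apply: eq_bigr => -[].
  apply: eq_bigr => l _.
  rewrite (@evalf_coef _ _ _ j.+1) ?size_poly // mulr_suml.
  apply: eq_bigr => m _; rewrite coef_poly ltn_ord inord_val /v /=.
  move: (x ^+ j) (xk0 j) (x ^+ m) (u l) (constf K _) => a a0 b' u' f'.
  by rewrite [RHS]mulrCA [a * _]mulrCA [a * _]mulrC divfK // mulrA mulrAC.
have z0 : z != 0.
  apply: contra_neq fik => z0; have hi : h i = 0.
    by apply: iu; rewrite zE z0 mulr0.
  have := coef_poly j.+1 (fun k => f (i, inord k)) k.
  by rewrite -/(h i) hi coef0 ltn_ord inord_val.
exists z => // r; have [rT|rT] := boolP (r \in T).
  exact: (hf r rT).
have rx : ord r x <= 0 by rewrite leNgt; apply/negP => /TP; apply/negP.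
have rS : r \notin S by apply: contraNN rT; apply: ST.
suff : vge r 0 z by rewrite D0 // oppr0; apply.
apply: subspace_sum => [|[l m]]; first exact: vge_subspace.
apply: (subspaceZ _ (vge_subspace r 0)); rewrite /v /= -[0](addr0 0).
apply: vgeM; first exact: u_int.
move=> _; rewrite ord_div ?xk0 // !ordX //.
by have := ltn_ord m; move: (ord r x) rx (nat_of_ord m) => o; clear; nia.
Qed.

End RiemannInequality.

(** * Divisors of degree 0 and multiples of p - q *)

Section DegreeZero.
Variables (F : finFieldType) (K : fieldExtType {fraction {poly F}}).
Hypothesis fc : full_constant_field F K.
Implicit Types (p q r s : place K) (x y z : K) (S : seq (place K)) (D : place K -> int).

Lemma degreeD S D D' : degree S (fun r => D r + D' r) = degree S D + degree S D'.
Proof. by rewrite /degree -big_split; apply: eq_bigr => r _; rewrite mulrDl. Qed.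

Lemma degreeZ S D m : degree S (fun r => m * D r) = m * degree S D.
Proof. by rewrite /degree mulr_sumr; apply: eq_bigr => r _; rewrite mulrA. Qed.

Lemma degree_point S p : uniq S -> p \in S ->
  degree S (fun r => (p == r)%:Z) = (place_deg p)%:Z.
Proof.
move=> uS pS; rewrite /degree (bigD1_seq p) //= eqxx mul1r big1 ?addr0 // => r rp.
by rewrite eq_sym (negPf rp) mul0r.
Qed.

(* If deg D < 0 then, for m large, -m D - s has a nonzero section y, and z^m y
   is a nonconstant element without poles. *)
Lemma degree_ge0 S D z : uniq S -> (forall r, r \notin S -> D r = 0) -> z != 0 ->
  (forall r, - D r <= ord r z) -> 0 <= degree S D.
Proof.
move=> uS D0 z0 zD; have [S0|S0] := eqVneq S [::].
  by rewrite S0 /degree big_nil.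
have [C hC] := riemann_inequality uS S0.
rewrite leNgt; apply/negP => neg.
have [s sS] : exists s, s \in S.
  by case: (S) S0 => // s S' _; exists s; rewrite mem_head.
(* As deg D <= -1, the divisor - m D - s has degree at least m - deg s = |C|. *)
pose m := (`|C| + place_deg s)%N.
have [||y y0 yD] := hC (fun r => - m%:Z * D r + (-1) * (s == r)%:Z).
- move=> r rS; rewrite D0 // (_ : (s == r) = false) ?mulr0 //.
  by apply/eqP => sr; rewrite -sr sS in rS.
- rewrite degreeD !degreeZ degree_point // /m.
  by move: (degree S D) neg (place_deg s) => a a0 f; clear -a0; nia.
have zm0 : z ^+ m != 0 by rewrite expf_neq0.
have ge r : (s == r)%:Z <= ord r (z ^+ m * y).
  rewrite ord_mul // ordX //; have := yD r; have := zD r.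
  by move: (D r) (ord r z) (ord r y) (_%:Z) (m) => a b c e n; clear; nia.
have [|c zy] := no_pole_constant (x := z ^+ m * y) fc.
  by move=> r _; apply: le_trans (ge r).
have c0 : c != 0.
  by apply: contraTneq (mulf_neq0 zm0 y0) => c0; rewrite zy c0 rmorph0 eqxx.
by have := ge s; rewrite eqxx zy ord_constf.
Qed.

Let ext_degree S D p m : uniq S -> (forall r, r \notin S -> D r = 0) ->
  exists T, [/\ uniq T, forall r, r \notin T -> D r - m * (p == r)%:Z = 0
    & degree T (fun r => D r - m * (p == r)%:Z) = degree S D - m * (place_deg p)%:Z].
Proof.
move=> uS D0; pose T := undup (p :: S).
have uT : uniq T by apply: undup_uniq.
have pT : p \in T by rewrite mem_undup mem_head.
have ST : {subset S <= T} by move=> r rS; rewrite mem_undup inE rS orbT.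
exists T; split=> // [r rT|].
  rewrite D0 ?(contraNN _ rT) //; last exact: ST.
  by rewrite (_ : (p == r) = false) ?mulr0 //; apply/eqP => pr; rewrite -pr pT in rT.
rewrite -(degree_subset uS uT ST D0) -mulNr -(degree_point uT pT) -degreeZ -degreeD.
by apply: eq_bigr => r _; rewrite mulNr.
Qed.

(** With m = D r + ord_r z, the element z is still a section of D - m r, whose degree is therefore
    nonnegative. *)
Lemma degree_excess S D z r : uniq S -> (forall r, r \notin S -> D r = 0) -> z != 0 ->
  (forall r, - D r <= ord r z) -> (D r + ord r z) * (place_deg r)%:Z <= degree S D.
Proof.
move=> uS D0 z0 zD; have [T [uT T0 dT]] := ext_degree r (D r + ord r z) uS D0.
rewrite -subr_ge0 -dT; apply: (degree_ge0 uT T0 z0) => s.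
have [->|rs] := eqVneq r s; last by rewrite mulr0 subr0 zD.
by rewrite mulr1 opprB addrC addrA addNr add0r.
Qed.

Lemma coeff_diff_div p q j r :
  coeff r (diff_div p q j) = j%:Z * (p == r)%:Z - j%:Z * (q == r)%:Z.
Proof.
rewrite /diff_div coeffB !coeffMn !coeffU !mul1r.
by rewrite -(natz j) -(natz (p == r)) -(natz (q == r)) !mulr_natl.
Qed.

Let Dpq p q (m n : int) r : int := m * (p == r)%:Z - n * (q == r)%:Z.

Let Dpq_supp p q m n r : r \notin undup [:: p; q] -> Dpq p q m n r = 0.
Proof.
rewrite mem_undup !inE negb_or /Dpq => /andP [rp rq].
by rewrite ![_ == r]eq_sym (negPf rp) (negPf rq) !mulr0.
Qed.

Let Dpq_degree p q m n : degree (undup [:: p; q]) (Dpq p q m n) =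
  m * (place_deg p)%:Z - n * (place_deg q)%:Z.
Proof.
have uS := undup_uniq [:: p; q].
rewrite -!(degree_point uS) ?mem_undup ?inE ?eqxx ?orbT // -mulNr -!degreeZ -degreeD.
by apply: eq_bigr => r _; rewrite mulNr.
Qed.

Section EqualDegrees.
Variables (p q : place K).
Hypothesis pq_deg : place_deg p = place_deg q.

(** The divisor has degree 0 and places have positive degree, so [degree_excess] leaves no excess at
    any r. *)
Lemma riemann_roch_diff_div j z : z != 0 -> riemann_roch (diff_div p q j) z ->
  forall r, ord r z = - coeff r (diff_div p q j).
Proof.
move=> z0 /(_ z0) hz r; apply/eqP; rewrite eq_le hz andbT.
have zD s : - Dpq p q j j s <= ord s z by rewrite /Dpq -coeff_diff_div.
have := degree_excess r (undup_uniq _) (@Dpq_supp p q j j) z0 zD.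
rewrite Dpq_degree pq_deg subrr /Dpq -coeff_diff_div; have := place_deg_gt0 r.
by move: (place_deg r) (ord r z) (coeff r _) => f o c; clear; nia.
Qed.

Lemma riemann_roch_generator j z : z != 0 -> riemann_roch (diff_div p q j) z ->
  generates (riemann_roch (diff_div p q j)) z.
Proof.
move=> z0 hz x; split=> [hx|[c ->]]; last first.
  rewrite /riemann_roch /= mulf_eq0 negb_or fmorph_eq0 => /andP [c0 _] r.
  by rewrite ord_mul ?fmorph_eq0 // ord_constf // add0r; apply: hz.
have [->|x0] := eqVneq x 0; first by exists 0; rewrite rmorph0 mul0r.
have [|c hc] := no_pole_constant (x := x / z) fc; last by exists c; rewrite -hc divfK.
by move=> r _; rewrite ord_div // !(@riemann_roch_diff_div j) // subrr.
Qed.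

(** The value 0 of [dim_mod] may also mean that there is no finite basis. A nonzero section excludes
    both readings: it is itself a basis, and no basis is empty. *)
Lemma dim_div_diff_div_neq0 j : dim_div (diff_div p q j) != 0%N <->
  exists2 z, z != 0 & riemann_roch (diff_div p q j) z.
Proof.
have s0 : subspace [set (0 : K)]%classic.
  by split=> // a y1 y2 -> ->; rewrite mulr0 addr0.
rewrite /dim_div /dim_mod; split=> [|[z z0 hz]].
  case: xgetP => // n _ [b /(is_basis_modP _ _ s0) [[Vb ib] _]] n0.
  case: n n0 b Vb ib => // n _ b Vb ib.
  exists (tnth b ord0); last exact: Vb.
  apply/eqP => b0; have := ib (delta_mx 0 ord0).
  rewrite /lincomb (bigD1 ord0) //= b0 mulr0 add0r big1 => [/(_ erefl)|i i0].
    by move/matrixP/(_ 0 ord0)/eqP; rewrite !mxE !eqxx oner_eq0.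
  by rewrite mxE (negPf i0) andbF rmorph0 mul0r.
have gz := riemann_roch_generator z0 hz.
have ex : exists n, exists b : n.-tuple K,
    is_basis_mod (riemann_roch (diff_div p q j)) [set 0]%classic b.
  exists 1%N, [tuple z]; split=> [i|x /gz [c ->]].
    by rewrite ord1; apply: hz.
  exists (const_mx c); split=> [|d]; rewrite big_ord1 /=.
    by rewrite mxE; apply: subrr.
  rewrite -mulrBl => /eqP; rewrite mulf_eq0 (negPf z0) orbF subr_eq0 => /eqP.
  by move/fmorph_inj => cd; apply/rowP => i; rewrite ord1 mxE.
have [b [Vb ib]] := xgetPex 0%N ex.
apply/negP => /eqP n0; move: b Vb ib; rewrite n0 => b _ /(_ z hz) [c [+ _]].
by rewrite big_ord0 subr0 => /= zz; rewrite zz eqxx in z0.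
Qed.

(* If x has its poles at p only, two of its first |F|^d + 1 powers are congruent
   modulo any other place of degree at most d. *)
Lemma exists_places_of_bounded_degree d x : x != 0 -> 0 < ord q x ->
    (forall r, r != p -> 0 <= ord r x) ->
  exists S, forall r, r != p -> (place_deg r <= d)%N -> r \in S.
Proof.
move=> x0 qx xp; pose B := (#|F| ^ d)%N.
(* G is nonzero because distinct powers of x have distinct orders at q, and each place to be listed
   is one of its finitely many zeros. *)
pose G := \prod_(ab : 'I_B.+1 * 'I_B.+1 | ab.1 != ab.2) (x ^+ ab.1 - x ^+ ab.2).
have G0 : G != 0.
  apply/prodf_neq0 => -[a b] /= ab; rewrite subr_eq0; apply: contraNneq ab => xab.
  have : ord q (x ^+ a) = ord q (x ^+ b) by rewrite xab.
  rewrite !ordX // => h; apply/eqP/val_inj => /=.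
  by move: (ord q x) qx (nat_of_ord a) (nat_of_ord b) h => o; clear; nia.
have [S [uS SG]] := exists_zeros G0.
exists S => r rp rd; apply/SG.
suff : vge r 1 G by move/(_ G0).
have Ox : vge r 0 x by move=> _; apply: xp.
have [b [_ [_ sb]]] := place_deg_basis r.
have OX (a : 'I_B.+1) : vge r 0 (x ^+ a).
  exact: (subalgebraX a (vge_subalgebra r) Ox).
have [c hc] := choice (fun a => sb _ (OX a)).
have /injectivePn [a [a' aa' caa']] : ~~ injectiveb c.
  apply/negP => /injectiveP /leq_card; rewrite card_ord card_mx mul1n leqNgt ltnS.
  by rewrite leq_exp2l ?rd // finNzRing_gt1.
rewrite /G (bigD1 (a, a')) //= -[1](addr0 1); apply: vgeM.
  have -> : x ^+ a - x ^+ a' =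
      (x ^+ a - lincomb b (c a)) - (x ^+ a' - lincomb b (c a')).
    by rewrite caa'; ring.
  by apply: (subspaceB (vge_subspace r 1)); apply: hc.
have aO := vge_subalgebra r.
apply: (big_ind (vge r 0)) => [|y z|[k l] _]; first exact: subalgebra1.
  by case: aO => _ _; apply.
by apply: (subspaceB (vge_subspace r 0)); apply: OX.
Qed.

Lemma exists_section_diff_div : exists2 j, (1 <= j)%N &
  exists2 z, z != 0 & riemann_roch (diff_div p q j) z.
Proof.
have [pq|pq] := eqVneq p q.
  exists 1%N => //; exists 1; first exact: oner_neq0.
  by move=> _ r; rewrite coeff_diff_div pq subrr ord_one.
have uS := undup_uniq [:: p; q].
have [|C hC] := riemann_inequality uS.
  by apply/eqP => h; have := mem_head p [:: q]; rewrite -mem_undup h.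
(* T has a zero at q and no pole outside p. The divisor has degree (|C| + deg q - 1) deg q >= C. *)
have [|T T0 TD] := hC (Dpq p q (`|C| + place_deg q)%N%:Z 1) (@Dpq_supp _ _ _ _).
  rewrite Dpq_degree pq_deg; have := place_deg_gt0 q.
  by move: (place_deg q) => f; clear; nia.
(* N = |C| gives all the divisors (N + i) p - i q the same degree d >= C. *)
pose N := `|C|%N; pose d := (N * place_deg p)%N.
pose D (i : nat) := Dpq p q (N + i)%N i.
have degD i : degree (undup [:: p; q]) (D i) = d%:Z.
  rewrite /D Dpq_degree pq_deg /d pq_deg -mulrBl PoszD PoszM; congr (_ * _).
  by rewrite addrK.
have hx i : exists x, x != 0 /\ forall r, - D i r <= ord r x.
  have [|x x0 xD] := hC (D i) (@Dpq_supp _ _ _ _); last by exists x.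
  rewrite degD /d /N; have := place_deg_gt0 p.
  by move: (place_deg p) => f; clear; nia.
have [x xP] := choice hx.
pose E i r := D i r + ord r (x i).
have E_ge0 i r : 0 <= E i r by case: (xP i) => _ /(_ r); rewrite /E; lia.
have E_le i r : E i r * (place_deg r)%:Z <= d%:Z.
  by case: (xP i) => x0 xD; rewrite -(degD i); apply: degree_excess => //; exact: Dpq_supp.
have [||S hS] := @exists_places_of_bounded_degree d T T0.
- have := TD q; rewrite /Dpq eqxx (negPf pq) mulr0 mulr1 sub0r opprK.
  exact: lt_le_trans.
- move=> r rp; apply: le_trans (TD r); rewrite /Dpq eq_sym (negPf rp) mulr0 sub0r opprK.
  by rewrite mul1r.
have E0 i r : r \notin p :: S -> E i r = 0.
  rewrite inE negb_or => /andP [rp rS]; have := E_ge0 i r; have := E_le i r.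
  have : (d < place_deg r)%N by rewrite ltnNge; apply: contraNN rS; apply: hS.
  by move: (E i r) (place_deg r) => e f; clear; nia.
pose n := size (p :: S).
(* The leftover E i vanishes off p :: S and has coefficients between 0 and d, so [inord] loses
   nothing and [code i] determines E i. *)
pose code i : {ffun 'I_n -> 'I_d.+1} := [ffun k => inord `|E i (nth p (p :: S) (nat_of_ord k))|%N].
have code_inj i i' : code i = code i' -> E i =1 E i'.
  move=> ii' r; have [rS|rS] := boolP (r \in p :: S); last by rewrite !E0.
  have k : (index r (p :: S) < n)%N by rewrite index_mem.
  have e_lt i0 : (`|E i0 r| < d.+1)%N.
    have := E_le i0 r; have := E_ge0 i0 r; have := place_deg_gt0 r.
    by move: (E i0 r) (place_deg r) => e f; clear; nia.
  have := congr1 (fun c : {ffun _ -> _} => nat_of_ord (c (Ordinal k))) ii'.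
  rewrite !ffunE /= -[if _ then _ else _]/(index r (p :: S)) nth_index // !inordK //.
  by have := E_ge0 i r; have := E_ge0 i' r; lia.
pose m := #|{ffun 'I_n -> 'I_d.+1}|.
have /injectivePn [a [b ab cab]] : ~~ injectiveb (fun i : 'I_m.+1 => code i).
  by apply/negP => /injectiveP /leq_card; rewrite card_ord ltnn.
have [i [i' [ii' ci]]] : exists i i', (i < i')%N /\ code i = code i'.
  have [lt|lt|/val_inj e] := ltngtP a b; last by rewrite e eqxx in ab.
    by exists a, b.
  by exists b, a.
have [xi0 _] := xP i; have [xi0' _] := xP i'.
exists (i' - i)%N; first by rewrite subn_gt0.
(* Equal leftovers give div(x_i' / x_i) = D i - D i' = (i' - i)(q - p). *)
exists (x i' / x i) => [|_ r]; first by rewrite mulf_neq0 ?invr_eq0.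
rewrite ord_div // coeff_diff_div -subzn ?(ltnW ii') //.
have := code_inj _ _ ci r; rewrite /E /D /Dpq !PoszD.
by move: (ord r (x i)) (ord r (x i')) (_%:Z) (_%:Z) => o o' e e'; clear; nia.
Qed.

End EqualDegrees.
End DegreeZero.

(** * Non-squares and the correctness of the procedure *)

(** If every element were a square, squaring would be a surjection of a finite set onto itself,
    hence injective, although 1 and -1 have the same square. *)
Lemma exists_nonsquare (F : finFieldType) : (-1 : F) != 1 ->
  exists zeta : F, nonsquare zeta.
Proof.
move=> n11; apply: contrapT => no.
have sq (z : F) : exists c, c ^+ 2 = z.
  have [->|z0] := eqVneq z 0; first by exists 0; rewrite expr0n.
  apply: contrapT => h; apply: no; exists z; split=> // c.
  by apply/eqP => zc; apply: h; exists c.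
have [g hg] := choice sq.
have can := canF_sym (hg : cancel g (fun c : F => c ^+ 2)).
by case/eqP: n11; apply: (can_inj can); rewrite sqrrN.
Qed.

Theorem mainTheorem4 (F : finFieldType) (K : fieldExtType {fraction {poly F}})
    (ell : nat) (hchar : ell \in [pchar K]) (hodd : odd ell)
    (hconst : full_constant_field F K)
    (p q : place K) (hdeg : place_deg p = place_deg q) :
  (exists k : nat, is_first_index p q k) /\
  forall coin : bool,
    (exists beta : K, procedure_output p q coin beta) /\
    (forall beta : K, procedure_output p q coin beta -> singular beta).
Proof.
have nz j := dim_div_diff_div_neq0 hconst hdeg j.
have [k kP] : exists k, is_first_index p q k.
  have [j j1 /nz dj] := exists_section_diff_div hconst hdeg.
  pose P j := `[< (1 <= j)%N /\ dim_div (diff_div p q j) != 0%N >].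
  have exP : exists j, P j by exists j; apply/asboolP.
  case: (ex_minnP exP) => k /asboolP [k1 dk] kmin.
  by exists k; split=> // i i1 di; apply: kmin; apply/asboolP.
split=> [|coin]; first by exists k.
split=> [|beta].
  have [ko|ke] := boolP (odd k); last first.
    have [_ /nz [z z0 hz] _] := kP.
    by exists z; apply: Output_even kP ke _; apply: riemann_roch_generator.
  case: coin; last by exists 1; apply: Output_one kP ko.
  have [|zeta zetaP] := @exists_nonsquare F.
    (* If -1 = 1, then 2 = 0 in K, so the odd prime [ell] would divide 2. *)
    apply/eqP => e11; have [ell_prime _] := andP hchar.
    have : (2%:R : K) == 0.
      by rewrite -(rmorph_nat (constf K)) mulr2n -{1}e11 addNr rmorph0.
    rewrite -(dvdn_pcharf hchar) dvdn_prime2 // => /eqP ell2.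
    by rewrite ell2 in hodd.
  by exists (constf K zeta); apply: Output_nonsquare kP ko zetaP.
case=> [i _ {}beta [_ /nz [z z0 hz] _] ie gen|i zeta _ _ [zeta0 _]|i _ _].
(* The generator is nonzero because z is a multiple of it; its divisor is then i (q - p) with i
   even. *)
- have Vbeta : riemann_roch (diff_div p q i) beta.
    by apply/gen; exists 1; rewrite rmorph1 mul1r.
  have beta0 : beta != 0.
    have [c zc] := (gen z).1 hz; apply: contraNneq z0 => b0.
    by rewrite zc b0 mulr0.
  split=> // r; rewrite (riemann_roch_diff_div hconst hdeg beta0 Vbeta).
  rewrite coeff_diff_div -mulrBr -mulrN dvdz_mulr //.
  by rewrite dvdzE /= dvdn2.
- split=> [|r]; first by rewrite fmorph_eq0.
  by rewrite ord_constf.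
- split=> [|r]; first exact: oner_neq0.
  by rewrite ord_one.
Qed.
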